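(* Let $G$ be a Roelcke precompact Polish group. Then $\mathrm{WAP}(G)=\mathrm{Asp}(G)=\mathrm{SUC}(G)$.
   Context: A Polish group $G$ is Roelcke precompact if for every neighborhood $U$ of the identity there is a finite set $F\subset G$ with $UFU=G$. $G$ is regarded as a $G$-space via the left translation action; for a $G$-space $X$, $G$ acts on the space $\mathcal{C}(X)$ of bounded continuous real functions by $(gh)(x)=h(g^{-1}x)$, and $\mathcal{C}(X)$ carries the sup norm. A compactification of a $G$-space $X$ is a continuous $G$-equivariant map $\nu\colon X\to Y$ with dense image into a compact Hausdorff $G$-space $Y$; $h\in\mathcal{C}(X)$ comes from $\nu$ if $h=\tilde h\circ\nu$ for some $\tilde h\in\mathcal{C}(Y)$. A function $h\in\mathcal{C}(X)$ is right uniformly continuous ($\mathrm{RUC}$) if for every $\epsilon>0$ there is a neighborhood $U$ of the identity with $|h(g^{-1}x)-h(x)|<\epsilon$ for all $x\in X$, $g\in U$; these are exactly the functions coming from some compactification. $\mathrm{WAP}(X)$: functions $h\in\mathcal{C}(X)$ whose orbit $Gh$ is relatively compact in the weak topology of $\mathcal{C}(X)$. $\mathrm{Asp}(X)$ (Asplund functions): functions coming from an Asplund-representable compactification of $X$; equivalently, functions $h$ coming from some compactification $\nu\colon X\to Y$ whose extension $\tilde h$ has fragmented orbit: for every nonempty $B\subset Y$ and $\epsilon>0$ there is an open $O\subset Y$ with $B\cap O\neq\emptyset$ and $|\tilde h(gy)-\tilde h(gy')|<\epsilon$ for all $g\in G$, $y,y'\in B\cap O$. $\mathrm{SUC}(X)$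 (strongly uniformly continuous): functions $h\in\mathrm{RUC}(X)$ coming from a compactification $\nu\colon X\to Y$ (equivalently, from any compactification from which $h$ comes) whose extension $\tilde h$ satisfies: for every $y\in Y$ and $\epsilon>0$ there is a neighborhood $U$ of the identity of $G$ with $|\tilde h(gy)-\tilde h(guy)|<\epsilon$ for all $g\in G$, $u\in U$. *)

(* Defs.v *)
From HB Require Import structures.
From mathcomp Require Import all_boot all_order all_algebra.
From mathcomp Require Import all_classical all_reals all_analysis.

Set Implicit Arguments.
Unset Strict Implicit.
Unset Printing Implicit Defensive.

Import Order.TTheory GRing.Theory Num.Theory.
Import numFieldNormedType.Exports.

Local Open Scope classical_set_scope.
Local Open Scope ring_scope.

(** * Polish groups *)

HB.mixin Record isTopologicalGroup G & Group G & Topological G := {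
  mulg_continuous : continuous (fun z : G * G => (z.1 * z.2)%g) ;
  invg_continuous : continuous (fun g : G => g^-1%g)
}.

#[short(type="topologicalGroupType")]
HB.structure Definition TopologicalGroup :=
  {G of Group G & Topological G & isTopologicalGroup G}.

Definition separable_space (T : topologicalType) :=
  exists2 D : set T, countable D & dense D.

(* d is a metric inducing the topology of T, and it is complete. *)
Record complete_compatible_metric (R : realType) (T : topologicalType)
    (d : T -> T -> R) : Prop := CompleteCompatibleMetric {
  compatible_metric_ge0 : forall x y, 0 <= d x y ;
  compatible_metric_eq0 : forall x y, d x y = 0 <-> x = y ;
  compatible_metric_sym : forall x y, d x y = d y x ;
  compatible_metric_triangle : forall x y z, d x z <= d x y + d y z ;
  compatible_metric_nbhs : forall x (A : set T), nbhs x A <->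
    exists2 e : R, 0 < e & [set y | d x y < e] `<=` A ;
  compatible_metric_complete : forall u : nat -> T,
    (forall e : R, 0 < e -> exists N : nat, forall m n : nat,
      (N <= m)%N -> (N <= n)%N -> d (u m) (u n) < e) ->
    exists l : T, u @ \oo --> l
}.

Definition polish (R : realType) (T : topologicalType) :=
  separable_space T /\ exists d : T -> T -> R, complete_compatible_metric d.

Definition roelcke_precompact (G : topologicalGroupType) :=
  forall U : set G, nbhs (1%g : G) U ->
    exists2 F : set G, finite_set F &
      [set (w * v)%g | w in [set (u * f)%g | u in U & f in F] & v in U] = setT.

(** * G-spaces and their compactifications *)

Record gspace (G : topologicalGroupType) := GSpace {
  gspace_sort :> topologicalType ;
  gact : G -> gspace_sort -> gspace_sort ;
  gact1 : forall x, gact 1%g x = x ;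
  gactM : forall g k x, gact (g * k)%g x = gact g (gact k x) ;
  gact_continuous :
    continuous (fun z : G * gspace_sort => gact z.1 z.2)
}.

Definition left_translation (G : topologicalGroupType) : gspace G :=
  @GSpace G G (fun g x => (g * x)%g) (@mul1g G)
    (fun g k x => esym (mulgA g k x)) mulg_continuous.

Record compactification (G : topologicalGroupType) (X Y : gspace G)
    (nu : X -> Y) : Prop := Compactification {
  compactification_compact : compact [set: Y] ;
  compactification_hausdorff : hausdorff_space Y ;
  compactification_continuous : continuous nu ;
  compactification_equivariant : forall g x, nu (gact g x) = gact g (nu x) ;
  compactification_dense : dense (range nu)
}.

(** * The normed space of bounded continuous real functions *)

Section BoundedContinuous.
Context (R : realType) (X : topologicalType).

Definition cb_pred : {pred X -> R} :=
  [pred h | `[< continuous h /\ bounded_fun h >]].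

Lemma cb_predP (h : X -> R) :
  reflect (continuous h /\ exists M : R, forall x, `|h x| <= M) (h \in cb_pred).
Proof.
apply: (iffP idP) => [/asboolP[hc [M [_ hM]]]|[hc [M hM]]].
  split=> //; exists (M + 1) => x; apply: (hM (M + 1)) => //.
  by rewrite ltrDl.
apply/asboolP; split=> //; exists M; split; first exact: num_real.
by move=> N MN x _; exact: le_trans (hM x) (ltW MN).
Qed.

Lemma cb_submod_closed : submod_closed cb_pred.
Proof.
split.
  apply/cb_predP; split; first by move=> x; exact: cvg_cst.
  by exists 0 => x; rewrite normr0.
move=> a f g /cb_predP[fc [M fM]] /cb_predP[gc [N gN]].
apply/cb_predP; split.
  move=> x; apply: cvgD (gc x); apply: cvgM (fc x); exact: cvg_cst.
exists (`|a| * M + N) => x.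
by rewrite (le_trans (ler_normD _ _))// lerD// normrM ler_wpM2l.
Qed.

HB.instance Definition _ := GRing.isSubmodClosed.Build R (X -> R) cb_pred
  cb_submod_closed.

Record cb := Cb { cb_fun :> X -> R ; _ : cb_fun \in cb_pred }.

HB.instance Definition _ := [isSub for cb_fun].
HB.instance Definition _ := [Choice of cb by <:].
HB.instance Definition _ := [SubChoice_isSubLmodule of cb by <:].

Definition sup_norm (h : cb) : R := sup (range (fun x => `|h x|)).
End BoundedContinuous.

Section SupNorm.
Context (R : realType) (X : topologicalType).
Implicit Types h k : cb R X.

Lemma sup_norm_ub h x : `|h x| <= sup_norm h.
Proof.
apply: sup_upper_bound; last by exists x.
split; first by exists `|h x|, x.
have /cb_predP[_ [M hM]] := valP h.
by exists M => _ [y _ <-]; exact: hM.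
Qed.

Lemma sup_norm_le h (M : R) : 0 <= M ->
  (forall x, `|h x| <= M) -> sup_norm h <= M.
Proof.
move=> M0 hM; rewrite /sup_norm.
have [->|/set0P ne] := eqVneq (range (fun x => `|h x|)) set0.
  by rewrite sup0.
by apply: ge_sup => // _ [x _ <-].
Qed.

Lemma sup_norm_ge0 h : 0 <= sup_norm h.
Proof.
rewrite /sup_norm.
have [->|/set0P[_ [x _ _]]] := eqVneq (range (fun x => `|h x|)) set0.
  by rewrite sup0.
by rewrite (le_trans _ (sup_norm_ub h x)).
Qed.

Lemma sup_norm_triangle h k : sup_norm (h + k) <= sup_norm h + sup_norm k.
Proof.
have le := @sup_norm_le (h + k).
apply: le => [|x]; first by rewrite addr_ge0// sup_norm_ge0.
by rewrite (le_trans (ler_normD _ _))// lerD// sup_norm_ub.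
Qed.

Lemma sup_normZ (a : R) h : sup_norm (a *: h) = `|a| * sup_norm h.
Proof.
have le (b : R) (f : cb R X) : sup_norm (b *: f) <= `|b| * sup_norm f.
  have leb := @sup_norm_le (b *: f).
  apply: leb => [|x]; first by rewrite mulr_ge0// sup_norm_ge0.
  by rewrite normrM ler_wpM2l// sup_norm_ub.
apply/eqP; rewrite eq_le le/=.
have [->|a0] := eqVneq a 0; first by rewrite normr0 mul0r sup_norm_ge0.
rewrite -{1}(scale1r h) -(mulVf a0) -scalerA.
by rewrite -ler_pdivlMl ?normr_gt0// -normfV le.
Qed.

Lemma sup_norm_eq0 h : sup_norm h = 0 -> h = 0.
Proof.
move=> h0; apply/val_inj/funext => x /=.
by apply/eqP; rewrite -normr_le0 -h0 sup_norm_ub.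
Qed.

HB.instance Definition _ := Lmodule_isNormed.Build R (cb R X)
  sup_norm_triangle sup_normZ sup_norm_eq0.
End SupNorm.

(** * The weak topology *)

Section Weak.
Context (R : realType) (V : normedModType R).

Definition dual := {phi : {linear V -> R} | continuous phi}.

HB.instance Definition _ := gen_eqMixin dual.
HB.instance Definition _ := gen_choiceMixin dual.

(* The pairing of V with its dual, as a map into the product R^(dual). *)
Definition dual_eval (v : V) : prod_topology (fun _ : dual => R) :=
  fun phi => sval phi v.

Definition weak : topologicalType := initial_topology dual_eval.
End Weak.

Definition relatively_weakly_compact (R : realType) (V : normedModType R)
    (A : set V) :=
  compact (closure (A : set (weak V))).

(** * WAP, Asplund and SUC functions *)

Section Functions.
Context (R : realType) (G : topologicalGroupType).

Section Translate.
Context (X : gspace G) (g : G) (h : cb R X).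

Lemma translate_subproof :
  (fun x => h (gact g^-1%g x)) \in @cb_pred R X.
Proof.
have /cb_predP[hc [M hM]] := valP h.
apply/cb_predP; split; last by exists M => z; exact: hM.
move=> x; apply: (@continuous_comp _ _ _ (fun x : X => gact g^-1%g x) h).
  apply: (@continuous_comp _ _ _ (fun x : X => (g^-1%g, x))
    (fun z : G * X => gact z.1 z.2)); last exact: gact_continuous.
  by apply: cvg_pair; [exact: cvg_cst|exact: cvg_id].
exact: hc.
Qed.

Definition translate : cb R X := Cb translate_subproof.
End Translate.

Definition cb_orbit (X : gspace G) (h : cb R X) : set (cb R X) :=
  range (fun g : G => translate g h).

(* k is the extension of h along nu, that is, h comes from nu via k. *)
Definition extends (X Y : gspace G) (nu : X -> Y) (h : cb R X) (k : cb R Y) :=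
  forall x, h x = k (nu x).

Definition fragmented_orbit (Y : gspace G) (k : cb R Y) :=
  forall (B : set Y) (e : R), B !=set0 -> 0 < e ->
    exists O : set Y, [/\ open O, B `&` O !=set0 &
      forall g y y', (B `&` O) y -> (B `&` O) y' ->
        `|k (gact g y) - k (gact g y')| < e].

Definition strongly_uniformly_continuous (Y : gspace G) (k : cb R Y) :=
  forall (y : Y) (e : R), 0 < e ->
    exists2 U : set G, nbhs (1%g : G) U &
      forall g u, U u -> `|k (gact g y) - k (gact (g * u)%g y)| < e.

Definition RUC (X : gspace G) : set (cb R X) :=
  [set h | forall e : R, 0 < e ->
    exists2 U : set G, nbhs (1%g : G) U &
      forall x g, U g -> `|h (gact g^-1%g x) - h x| < e].

Definition WAP (X : gspace G) : set (cb R X) :=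
  [set h | relatively_weakly_compact (cb_orbit h)].

(* Asplund functions, described by fragmentability of the orbit on a
   compactification rather than by representations on Asplund spaces. *)
Definition Asp (X : gspace G) : set (cb R X) :=
  [set h | exists (Y : gspace G) (nu : X -> Y) (k : cb R Y),
    [/\ compactification nu, extends nu h k & fragmented_orbit k]].

Definition SUC (X : gspace G) : set (cb R X) :=
  @RUC X `&` [set h | exists (Y : gspace G) (nu : X -> Y) (k : cb R Y),
    [/\ compactification nu, extends nu h k &
        strongly_uniformly_continuous k]].
End Functions.

Arguments RUC R {G} X.
Arguments WAP R {G} X.
Arguments Asp R {G} X.
Arguments SUC R {G} X.

(* Main.v *)
Require Import Defs.
From HB Require Import structures.
From mathcomp Require Import all_boot all_order all_algebra.
From mathcomp Require Import all_classical all_reals all_analysis.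
From mathcomp Require Import zify ring lra.

(* For a point [y] of a compactification with strongly uniformly continuous [k],
   the function [g |-> k (g y)] is left and right uniformly continuous, so it
   extends to the Roelcke compactification of [G], which is metrizable. Hence the
   pseudometric [sup_g |k (g y) - k (g y')|] is separable: it admits countable
   codes, and no Cantor scheme can produce [2^omega] uniformly separated points.

   - SUC implies Asplund: a set on which the orbit of [k] is not fragmented carries
     such a Cantor scheme.
   - Asplund implies SUC: fragment an orbit of [G].
   - SUC implies WAP: if [h] is not WAP, Grothendieck's double limit criterion gives
     arbitrarily long order patterns; by Roelcke precompactness the middle element
     of a long pattern can be chosen independently of its length, so that patterns
     split again and again into a Cantor scheme. That pointwise limits of the orbit
     are weak limits follows from an elementary bounded convergence theorem.
   - WAP implies SUC: the weak compactness of the orbit provides countable codes for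
     the translates of [h] and of its limits, and Baire category on the Polish group
     [G] turns them into uniform continuity. *)

Set Implicit Arguments.
Unset Strict Implicit.
Unset Printing Implicit Defensive.

Import Order.TTheory GRing.Theory Num.Theory.
Import numFieldNormedType.Exports.

Local Open Scope classical_set_scope.
Local Open Scope ring_scope.

(** * Countable codes and Cantor schemes *)

(** Up to [e], [Phi i] is determined by its values at representatives of a finite partition. These
    values rounded to multiples of [e], together with the index of the partition, are finite data
    and serve as the code. Passing to the representative, comparing there and passing back cost [e]
    each. *)
Lemma finite_partition_code (R : realType) (T I : Type) (C : nat -> finType)
    (c : forall n, T -> C n) (Phi : I -> T -> R) (e : R) : 0 < e ->
  (forall i, exists n, forall t t', c n t = c n t' ->
    `|Phi i t - Phi i t'| <= e) ->
  exists code : I -> nat, forall i j, code i = code j ->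
    forall t, `|Phi i t - Phi j t| <= e *+ 3.
Proof.
move=> e0 /choice[N NP].
have [[t0]|nT] := pselect (inhabited T); last first.
  by exists (fun=> 0%N) => i j _ t; exfalso; apply: nT.
(* [t0] stands in for a representative of an empty class. *)
pose rep n (a : C n) : T :=
  if pselect (exists t, c n t = a) is left ex then projT1 (cid ex) else t0.
have repP n t : c n (rep n (c n t)) = c n t.
  by rewrite /rep; case: pselect => [ex|[]]; [case: cid|exists t].
pose val i n := [seq Num.floor (Phi i (rep n a) / e) | a <- enum (C n)].
exists (fun i => pickle (N i, val i (N i))) => i j /(pcan_inj pickleK)[].
move=> Nij; rewrite -Nij => valij t.
have NjP := NP j; rewrite -Nij in NjP.
set r := rep (N i) (c (N i) t).
have di : `|Phi i t - Phi i r| <= e by apply: NP; rewrite repP.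
have dj : `|Phi j r - Phi j t| <= e by apply: NjP; rewrite repP.
have : Num.floor (Phi i r / e) = Num.floor (Phi j r / e).
  by move/eq_in_map: valij; apply; rewrite mem_enum.
move=> fl; have dr : `|Phi i r - Phi j r| <= e.
  have /andP[i1 i2] := floor_itv (Phi i r / e).
  have /andP[j1 j2] := floor_itv (Phi j r / e).
  rewrite -fl in j1 j2; rewrite intrD in i2 j2.
  rewrite -(ler_pM2r (x := e^-1)) ?invr_gt0// mulfV ?gt_eqF//.
  rewrite -[X in _ * X]gtr0_norm ?invr_gt0// -normrM mulrBl.
  by rewrite ler_norml; apply/andP; split; lra.
have -> : Phi i t - Phi j t =
  (Phi i t - Phi i r) + (Phi i r - Phi j r) + (Phi j r - Phi j t) by ring.
rewrite mulrSr mulr2n (le_trans (ler_normD _ _))// lerD//.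
by rewrite (le_trans (ler_normD _ _))// lerD.
Qed.

(* A tree whose nodes all split into [far] halves has 2^omega branches, and a
   countable code cannot tell them apart. *)
Lemma no_cantor_scheme (N I : Type) (child : N -> N -> Prop) (good : N -> Prop)
    (cl : N -> set I) (far : I -> I -> Prop) (code : I -> nat) (p0 : N) :
  good p0 ->
  (forall p, good p -> exists q : bool -> N,
    (forall b, good (q b) /\ child p (q b)) /\
    forall x y, cl (q false) x -> cl (q true) y -> far x y) ->
  (forall nu : nat -> N, (forall n, good (nu n)) ->
    (forall n, child (nu n) (nu n.+1)) -> exists x, forall n, cl (nu n) x) ->
  (forall x y, code x = code y -> ~ far x y) -> False.
Proof.
move=> g0 step branch codeP.
have : forall p : {p | good p}, exists q : bool -> {p | good p},
    (forall b, child (sval p) (sval (q b))) /\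
    forall x y, cl (sval (q false)) x -> cl (sval (q true)) y -> far x y.
  move=> [p gp] /=; have [q [gq farq]] := step p gp.
  exists (fun b => exist _ (q b) (proj1 (gq b))); split=> //= b.
  by case: (gq b).
case/choice => f fP.
pose nu := fix nu (eta : nat -> bool) n : {p | good p} :=
  if n is m.+1 then f (nu eta m) (eta m) else exist _ p0 g0.
have : forall eta, exists x, forall n, cl (sval (nu eta n)) x.
  move=> eta; apply: branch => n; first exact: svalP.
  by have [+ _] := fP (nu eta n); apply.
case/choice => x xP.
(* At the first level where two sequences differ, their branches leave a common node for [far]
   halves. *)
have x_inj eta eta' : code (x eta) = code (x eta') -> eta = eta'.
  move=> xx; apply/funext; elim/ltn_ind => n IH.
  have nuE : nu eta n = nu eta' n.
    elim: n IH => [//|n IHn] IH /=.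
    by rewrite (IH n)// IHn// => m /ltnW/IH.
  have := xP eta n.+1; have := xP eta' n.+1; rewrite /= nuE.
  have [_ farn] := fP (nu eta' n).
  case: (eta n) (eta' n) => -[]// x1 x2; exfalso.
    by apply: (codeP _ _ (esym xx)); exact: farn.
  by apply: (codeP _ _ xx); exact: farn.
(* Cantor's diagonal: [d] differs at [n] from the sequence whose branch has code [n]. *)
pose d n := `[< exists eta, code (x eta) = n /\ eta n = false >].
have [dn|ndn] := boolP (d (code (x d))).
  by have /asboolP[eta [/x_inj ->]] := dn; rewrite dn.
by move/asboolP: (ndn); apply; exists d; split=> //; exact/negbTE.
Qed.

Lemma compact_decreasing_nonempty (T : topologicalType) (K : set T)
    (D : nat -> set T) : compact K -> (forall n, closed (D n)) ->
  (forall n, D n.+1 `<=` D n) -> (forall n, K `&` D n !=set0) ->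
  exists x, K x /\ forall n, D n x.
Proof.
move=> Kc Dc dec ne.
have decl m n : (m <= n)%N -> D n `<=` D m.
  move=> /subnK <-; elim: (n - m)%N => [//|k IH] x Dx.
  by apply/IH/dec; rewrite addSn in Dx.
pose F := filter_from setT (fun n => K `&` D n).
have FF : ProperFilter F.
  apply: filter_from_proper => //; apply: filter_from_filter; first by exists 0%N.
  move=> i j _ _; exists (maxn i j) => // x [Kx Dx].
  by split; split=> //; apply: decl Dx; rewrite ?leq_maxl ?leq_maxr.
have FK : F K by exists 0%N => // x [].
have [x [Kx xc]] := Kc F FF FK.
exists x; split=> // n; apply: (Dc n) => U Ux.
have [|y [[_ Dy] Uy]] := xc (K `&` D n) U _ Ux; first by exists n.
by exists y.
Qed.

Lemma separable_sequence (T : topologicalType) (t0 : T) : separable_space T ->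
  exists s : nat -> T, forall O : set T, open O -> O !=set0 ->
    exists n, O (s n).
Proof.
move=> [D cD dD]; have : D !=set0.
  by have [x [_ Dx]] := dD setT (ex_intro _ t0 I) openT; exists x.
move=> D0; have [f] : exists f : nat -> T, D `<=` range f.
  have /countable_injP[f fI] := cD.
  exists (fun n => if pselect (exists x, D x /\ f x = n) is left ex
    then projT1 (cid ex) else t0) => x Dx.
  exists (f x) => //; case: pselect => [ex|[]]; last by exists x.
  by case: cid => z [Dz fzx] /=; apply: fI; rewrite ?inE.
move=> fD; exists f => O oO O0.
by have [x [Ox /fD[n _ nx]]] := dD O O0 oO; exists n; rewrite nx.
Qed.

(* Baire category in the guise of a Cantor scheme of balls *)
Lemma equicontinuity_point (R : realType) (T : topologicalType) (t0 : T)
    (X : Type) (Phi : T -> X -> R) :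
  (exists d : T -> T -> R, complete_compatible_metric d) ->
  (forall x, continuous (Phi ^~ x)) ->
  (forall e : R, 0 < e -> exists code : T -> nat, forall u v, code u = code v ->
    forall x, `|Phi u x - Phi v x| <= e) ->
  forall e : R, 0 < e -> exists u, \forall v \near u, forall x,
    `|Phi v x - Phi u x| <= e.
Proof.
move=> [d [d_ge0 d_eq0 dC dtri dnbhs dcomplete]] cont codes e e0.
apply: contrapT => /forallNP ndisc.
have e30 : 0 < e / 3 by rewrite divr_gt0.
have [code codeP] := codes _ e30.
have ball u r : 0 < r -> nbhs u [set v | d u v < r] by move=> r0; apply/dnbhs; exists r.
(* Nodes are closed balls, given by centre and radius; a child is nested in its parent by the
   triangle inequality and has at most half the radius. *)
apply: (@no_cantor_scheme (T * R) T
  (fun p q => d p.1 q.1 + q.2 <= p.2 /\ q.2 <= p.2 / 2)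
  (fun p => 0 < p.2) (fun p => [set v | d p.1 v <= p.2])
  (fun u v => exists x, e / 3 < `|Phi u x - Phi v x|) code (t0, 1)) => //=.
- move=> [u r] /= r0.
  have [v [uv [x xuv]]] : exists v, d u v < r / 2 /\ exists x, e < `|Phi v x - Phi u x|.
    apply: contrapT => nv; apply: (ndisc u).
    apply: filterS (ball u (r / 2) _); last by rewrite divr_gt0.
    move=> v /= duv x; rewrite leNgt; apply/negP => exv.
    by apply: nv; exists v; split=> //; exists x.
  (* The centres are separated by more than [e]; balls on which [Phi ^~ x] moves by less than
     [e / 3] keep a gap of [e / 3]. *)
  have near w : exists r', [/\ 0 < r', r' <= r / 2 &
      forall z, d w z <= r' -> `|Phi w x - Phi z x| < e / 3].
    have /cvgrPdist_lt/(_ _ e30)/dnbhs[s s0 sP] := cont x w.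
    exists (Num.min (s / 2) (r / 2)); split; first by rewrite lt_min !divr_gt0.
      by rewrite ge_min lexx orbT.
    move=> z zw; apply: sP => /=; apply: le_lt_trans zw _.
    by rewrite gt_min ltr_pdivrMr// ltr_pMr// ltr1n.
  have [ru [ru0 ru_r ruP]] := near u; have [rv [rv0 rv_r rvP]] := near v.
  exists (fun b => if b then (v, rv) else (u, ru)); split.
    move=> [] /=; split=> //; split=> //.
      by move: (ltW uv) rv_r; lra.
    by rewrite (_ : d u u = 0) ?add0r; [lra|exact/d_eq0].
  move=> y z /ruP uy /rvP vz; exists x.
  move: uy vz xuv; rewrite !ltr_norml => /andP[? ?] /andP[? ?].
  by rewrite !lter_normr => /orP[?|?]; apply/orP; [right|left]; lra.
- move=> nu r0 chi.
  have dr m n : d (nu n).1 (nu (n + m)%N).1 <= (nu n).2 - (nu (n + m)%N).2.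
    elim: m => [|m IH]; first by rewrite addn0 subrr (_ : d _ _ = 0)//; exact/d_eq0.
    rewrite addnS; have [c1 _] := chi (n + m)%N.
    by move: (dtri (nu n).1 (nu (n + m)%N).1 (nu (n + m).+1).1) IH c1; lra.
  (* Halving the radius outweighs the growth from [n + 1] to [n + 2], so this product never
     increases and the radii tend to 0. *)
  have rn n : (nu n).2 * n.+1%:R <= (nu 0%N).2.
    elim: n => [|n IH]; first by rewrite mulr1.
    have [_ c2] := chi n; apply: le_trans IH.
    have n2 : n.+2%:R <= 2 * n.+1%:R :> R by rewrite -natrM ler_nat; lia.
    apply: le_trans (ler_pM (ltW (r0 _)) (ler0n _ _) c2 n2) _.
    by rewrite mulrA divfK.
  have small s : 0 < s -> exists n, (nu n).2 < s.
    move=> s0; exists (Num.truncn ((nu 0%N).2 / s)).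
    have := rn (Num.truncn ((nu 0%N).2 / s)); set n := Num.truncn _ => rnn.
    rewrite -(ltr_pM2r (ltr0Sn R n)); apply: le_lt_trans rnn _.
    by rewrite mulrC -ltr_pdivrMr// truncnS_gt.
  have [|l ul] := dcomplete (fun n => (nu n).1).
    move=> s s0; have [|N Ns] := small (s / 2); first by rewrite divr_gt0.
    exists N => m n Nm Nn.
    move: (dr (m - N)%N N) (dr (n - N)%N N); rewrite !subnKC// => dm dn.
    move: (dtri (nu m).1 (nu N).1 (nu n).1) (r0 m) (r0 n) dm dn Ns.
    by rewrite (dC (nu m).1 (nu N).1); lra.
  exists l => n /=; apply/ler_addgt0Pr => s s0.
  have := ul _ (ball l s s0); move=> [M _ MP].
  have := MP (n + M)%N (leq_addl _ _) => /= lu.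
  move: (dr M n) (dtri (nu n).1 (nu (n + M)%N).1 l) lu (r0 (n + M)%N).
  rewrite (dC l).
  by lra.
- by move=> u v uv [x]; rewrite ltNge codeP.
Qed.

(** * Topological groups and G-spaces *)

Lemma cvg_initialP (S : choiceType) (T : topologicalType) (f : S -> T)
    (F : set_system S) (s : S) : Filter F ->
  F --> (s : initial_topology f) <-> f @ F --> f s.
Proof.
move=> FF; split=> [Fs|fFs].
  by move=> U /(@initial_continuous _ _ f s)/Fs.
move=> A; rewrite nbhsE => -[B [ [V oV <-] Vs] OA].
apply: filterS OA _; have := fFs V; apply.
exact: open_nbhs_nbhs.
Qed.

Lemma cvg_pointwiseP (I : Type) (T : topologicalType)
    (F : set_system (I -> T)) (f : I -> T) : Filter F ->
  F --> (f : prod_topology (fun _ : I => T)) <->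
  forall i, (fun g : I -> T => g i) @ F --> f i.
Proof.
move=> FF; split=> [Ff i|Ff].
  by have /cvg_sup/(_ i)/cvg_initialP := Ff; apply.
by apply/cvg_sup => i; apply/cvg_initialP; exact: Ff.
Qed.

Section TopologicalGroup.
Context (G : topologicalGroupType).
Implicit Types (U V : set G) (g : G).

Lemma cvg_mulg (T : Type) (F : set_system T) (f f' : T -> G) (a b : G) :
  Filter F -> f @ F --> a -> f' @ F --> b ->
  (fun t => (f t * f' t)%g) @ F --> (a * b)%g.
Proof.
move=> FF fa fb.
by apply: continuous2_cvg fa fb; exact: (@mulg_continuous G (a, b)).
Qed.

Lemma nbhs1_conj g U : nbhs (1%g : G) U ->
  \forall w \near (1%g : G), U (g * w * g^-1)%g.
Proof.
have : (fun w => (g * w * g^-1)%g) @ (1%g : G) --> (1%g : G).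
  rewrite [X in _ --> X](_ : 1 = g * 1 * g^-1)%g; last by rewrite mulg1 mulgV.
  by do 2?[apply: cvg_mulg]; try exact: cvg_cst; exact: cvg_id.
exact.
Qed.

Lemma nbhs1_inv U : nbhs (1%g : G) U -> \forall w \near (1%g : G), U (w^-1)%g.
Proof. by move=> U1; apply: invg_continuous; rewrite invg1. Qed.

Lemma nbhs_mull g U : nbhs g U -> \forall w \near (1%g : G), U (g * w)%g.
Proof.
have : (fun w => (g * w)%g) @ (1%g : G) --> g.
  by rewrite -[X in _ --> X]mulg1; apply: cvg_mulg; [exact: cvg_cst|exact: cvg_id].
exact.
Qed.

Lemma nbhs_mulr g U : nbhs g U -> \forall w \near (1%g : G), U (w * g)%g.
Proof.
have : (fun w => (w * g)%g) @ (1%g : G) --> g.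
  by rewrite -[X in _ --> X]mul1g; apply: cvg_mulg; [exact: cvg_id|exact: cvg_cst].
exact.
Qed.

Lemma polish_nbhs1_basis (R : realType) : polish R G ->
  exists V : nat -> set G, (forall n, nbhs (1%g : G) (V n)) /\
    forall U, nbhs (1%g : G) U -> exists n, V n `<=` U.
Proof.
move=> [_ [d [_ _ _ _ dnbhs _]]].
exists (fun n => [set g | d 1%g g < n.+1%:R^-1]); split=> [n|U /dnbhs[e e0 eU]].
  by apply/dnbhs; exists n.+1%:R^-1 => //; rewrite invr_gt0.
exists (Num.truncn e^-1) => g /= gn; apply: eU; apply: lt_trans gn _.
by rewrite -[ltRHS]invrK ltf_pV2 ?posrE ?invr_gt0// truncnS_gt.
Qed.

(** The label [c g] is the index in a finite [F] of the middle factor of [g]; the extra index keeps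
    the set of labels nonempty. *)
Lemma roelcke_partition U : roelcke_precompact G -> nbhs (1%g : G) U ->
  exists (n : nat) (c : G -> 'I_n.+1) (f : 'I_n.+1 -> G), forall g,
    exists u v, [/\ U u, U v & g = (u * f (c g) * v)%g].
Proof.
move=> rG /rG[F /finite_seqP[s ->] UFU].
have : forall g, exists i : 'I_(size s).+1, exists u v,
    [/\ U u, U v & g = (u * nth 1 s i * v)%g].
  move=> g; have : setT g by []; rewrite -UFU => -[_ [u Uu [f fs <-]]] [v Uv <-].
  exists (inord (index f s)), u, v; split=> //.
  by rewrite inordK ?nth_index// ltnS index_size.
by case/choice => c cP; exists (size s), c, (fun i => nth 1%g s i).
Qed.

End TopologicalGroup.

Section GSpace.
Context (R : realType) (G : topologicalGroupType).

Lemma cb_continuous (X : topologicalType) (h : cb R X) : continuous h.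
Proof. by have /cb_predP[] := valP h. Qed.

Lemma cb_bounded (X : topologicalType) (h : cb R X) :
  exists M : R, 0 < M /\ forall x, `|h x| <= M.
Proof.
have /cb_predP[_ [M hM]] := valP h; exists (`|M| + 1); split.
  by rewrite ltr_wpDl.
by move=> x; rewrite (le_trans (hM x))// (le_trans (ler_norm _))// lerDl.
Qed.

Lemma cvg_gact (X : gspace G) (T : Type) (F : set_system T) (f : T -> G)
    (f' : T -> X) (a : G) (b : X) :
  Filter F -> f @ F --> a -> f' @ F --> b ->
  (fun t => gact (f t) (f' t)) @ F --> gact a b.
Proof.
move=> FF fa fb.
by apply: continuous2_cvg fa fb; exact: (@gact_continuous G X (a, b)).
Qed.

Lemma gact_continuousl (X : gspace G) (x : X) : continuous (fun g : G => gact g x).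
Proof. by move=> g; apply: cvg_gact; [exact: cvg_id|exact: cvg_cst]. Qed.

Lemma gact_continuousr (X : gspace G) (g : G) : continuous (gact g : X -> X).
Proof. by move=> x; apply: cvg_gact; [exact: cvg_cst|exact: cvg_id]. Qed.

(** Joint continuity at [(y, 1)] gives a product neighbourhood, and compactness makes its factor in
    [G] common to all [y]. *)
Lemma compact_equicontinuous_action (Y : gspace G) (k : cb R Y) (e : R) :
  compact [set: Y] -> 0 < e ->
  \forall u \near (1%g : G), forall y, `|k (gact u y) - k y| < e.
Proof.
move=> /compact_near_coveringP Yc e0.
have : forall y : Y, [set: Y] y -> \forall y' \near y & u \near (1%g : G),
    `|k (gact u y') - k y'| < e.
  move=> y _.
  have kuy : k (gact z.2 z.1) @[z --> (y, 1%g : G)] --> k y.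
    apply: continuous_cvg; first exact: cb_continuous.
    rewrite -[X in _ --> X]gact1; apply: cvg_gact; [exact: cvg_snd|exact: cvg_fst].
  have k1 : k z.1 @[z --> (y, 1%g : G)] --> k y.
    apply: continuous_cvg; first exact: cb_continuous.
    exact: cvg_fst.
  have k0 : (k (gact z.2 z.1) - k z.1) @[z --> (y, 1%g : G)] --> (0 : R).
    by rewrite -(subrr (k y)); exact: cvgB.
  exact: (cvgr0Pnorm_lt _).1 k0 e e0.
move=> /(Yc G (nbhs (1%g : G)) (fun u y => `|k (gact u y) - k y| < e) _).
by apply: filterS => u uP y; exact: uP.
Qed.

(* [k] along an orbit is two-sided uniformly continuous, hence lives on the
   second countable Roelcke compactification. *)
Lemma strongly_uniformly_continuous_code (Y : gspace G) (k : cb R Y) :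
  polish R G -> roelcke_precompact G -> compact [set: Y] ->
  strongly_uniformly_continuous k ->
  forall e : R, 0 < e -> exists code : Y -> nat, forall y y',
    code y = code y' -> forall g, `|k (gact g y) - k (gact g y')| <= e.
Proof.
move=> pG rG Yc sucY e e0.
have [V [V1 Vbase]] := polish_nbhs1_basis pG.
have /choice[c cP] : forall n, exists p : {N : nat & G -> 'I_N.+1},
    exists f : 'I_(projT1 p).+1 -> G, forall g,
    exists u v, [/\ V n u, V n v & g = (u * f (projT2 p g) * v)%g].
  by move=> n; have [N [c [f fP]]] := roelcke_partition rG (V1 n);
    exists (existT _ N c), f.
have e12 : 0 < e / 12 by rewrite divr_gt0.
have e3 : 0 < e / 3 by rewrite divr_gt0.
have [|code codeP] := finite_partition_code (C := fun n => 'I_(projT1 (c n)).+1)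
    (c := fun n => projT2 (c n)) (Phi := fun y g => k (gact g y)) e3.
  move=> y; have [U U1 UP] := sucY y _ e12.
  have W1 := compact_equicontinuous_action k Yc e12.
  have [n VUW] := Vbase _ (filterI U1 W1); exists n.
  have [f fP] := cP n.
  (* For [g = u * f * v], uniform continuity of the action absorbs [u] and strong uniform continuity
     at [y] absorbs [v], at [e / 12] each. Elements with equal labels then differ by [e / 3], which
     the code triples to [e]. *)
  have near g : `|k (gact g y) - k (gact (f (projT2 (c n) g)) y)| <= e / 6.
    have [u [v [/VUW[_ Wu] /VUW[Uv _] gE]]] := fP g.
    rewrite {1}gE -mulgA gactM.
    have := Wu (gact (f (projT2 (c n) g) * v)%g y).
    have := UP (f (projT2 (c n) g)) v Uv.
    rewrite !ltr_norml ler_norml => /andP[? ?] /andP[? ?].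
    by apply/andP; split; lra.
  move=> g g' gg'; move: (near g) (near g'); rewrite gg' !ler_norml.
  by move=> /andP[? ?] /andP[? ?]; apply/andP; split; lra.
exists code => y y' /codeP yy' g; apply: le_trans (yy' g) _.
by rewrite -(mulr_natr (e / 3)) divfK.
Qed.

End GSpace.

(** * Asplund functions and SUC functions *)

Section DistanceSets.
Context (R : realType) (T : topologicalType) (f : T -> R).
Hypothesis fc : continuous f.

Let dist_continuous (c : R) : continuous (fun z => `|f z - c|).
Proof. by move=> z; apply: cvg_norm; apply: cvgB; [exact: fc|exact: cvg_cst]. Qed.

Lemma open_dist_lt (c r : R) : open [set z | `|f z - c| < r].
Proof. have /(_ [set x | x < r]) := (continuousP _).1 (@dist_continuous c).
by apply; exact: open_lt. Qed.

Lemma closed_dist_le (c r : R) : closed [set z | `|f z - c| <= r].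
Proof.
have /(_ [set x | x <= r]) := (continuous_closedP _).1 (@dist_continuous c).
by apply; exact: closed_le.
Qed.

End DistanceSets.

Section FragmentedOrbits.
Context (R : realType) (G : topologicalGroupType) (X : gspace G).

Lemma orbit_map_continuous (Y : gspace G) (k : cb R Y) (g : G) :
  continuous (fun y => k (gact g y)).
Proof.
by move=> y; apply: continuous_comp; [exact: gact_continuousr|exact: cb_continuous].
Qed.

Lemma extends_RUC (Y : gspace G) (nu : X -> Y) (h : cb R X) (k : cb R Y) :
  compactification nu -> extends nu h k -> RUC R X h.
Proof.
move=> [Yc _ _ nuE _] hk e e0.
have := nbhs1_inv (compact_equicontinuous_action k Yc e0) => U1.
exists [set u | forall y, `|k (gact u^-1%g y) - k y| < e]; first exact: U1.
by move=> x g /= gU; rewrite !hk nuE.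
Qed.

(** Fragmenting the orbit of [y] gives an open [V] around some [g0 y] on which all translates of [k]
    vary little. For [u] near 1 the point [g0 u y] is still in [V], and applying [g * g0^-1]
    transfers the estimate to [g y] and [g u y]. *)
Lemma fragmented_orbit_suc (Y : gspace G) (k : cb R Y) :
  fragmented_orbit k -> strongly_uniformly_continuous k.
Proof.
move=> frag y e e0.
have [|V [oV [_ [[g0 _ <-] Vg0y]] VP]] := frag (range (fun g => gact g y)) e _ e0.
  by exists (gact 1%g y), 1%g.
have V1 : \forall u \near (1%g : G), V (gact (g0 * u)%g y).
  apply: (@nbhs_mull G g0 (fun g => V (gact g y))).
  by apply: gact_continuousl; exact: open_nbhs_nbhs.
exists [set u | V (gact (g0 * u)%g y)]; first exact: V1.
move=> g u /= Vu.
have -> : gact g y = gact (g * g0^-1)%g (gact g0 y) by rewrite -gactM mulgVK.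
have -> : gact (g * u)%g y = gact (g * g0^-1)%g (gact (g0 * u)%g y).
  by rewrite -gactM mulgA mulgVK.
by apply: VP; split=> //.
Qed.

Lemma Asp_sub_SUC : Asp R X `<=` SUC R X.
Proof.
move=> h [Y [nu [k [nuY hk frag]]]]; split; first exact: extends_RUC nuY hk.
by exists Y, nu, k; split=> //; exact: fragmented_orbit_suc.
Qed.

(** If [B] and [e] defeat fragmentation, every open set meeting [B] contains two points of [B] that
    some [g] separates by [e]. Open pieces of tolerance [e / 4] around them have closures still
    [e / 2] apart under [g], so open sets meeting [B] form a Cantor scheme against the codes at
    scale [e / 3]. *)
Lemma suc_fragmented_orbit (Y : gspace G) (k : cb R Y) :
  polish R G -> roelcke_precompact G -> compact [set: Y] ->
  strongly_uniformly_continuous k -> fragmented_orbit k.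
Proof.
move=> pG rG Yc suck B e B0 e0; apply: contrapT => nfrag.
have e3 : 0 < e / 3 by rewrite divr_gt0.
have [code codeP] := strongly_uniformly_continuous_code pG rG Yc suck e3.
apply: (@no_cantor_scheme (set Y) Y (fun P Q => Q `<=` P)
  (fun P => open P /\ B `&` P !=set0) closure
  (fun y y' => exists g, e / 3 < `|k (gact g y) - k (gact g y')|) code setT).
- by split; [exact: openT|rewrite setIT].
- move=> P [oP BP].
  have [g [y [y' [[By Py] [By' Py'] gyy']]]] : exists g y y',
      [/\ (B `&` P) y, (B `&` P) y' & e <= `|k (gact g y) - k (gact g y')|].
    apply: contrapT => nex; apply: nfrag; exists P; split=> // g y y' Hy Hy'.
    by rewrite ltNge; apply/negP => ge; apply: nex; exists g, y, y'.
  pose z b := if b then y' else y.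
  have kg := @orbit_map_continuous Y k g.
  exists (fun b => P `&` [set x | `|k (gact g x) - k (gact g (z b))| < e / 4]).
  split=> [b|x x' xcl x'cl].
    split; last exact: subIsetl.
    split; first by apply: openI => //; exact: open_dist_lt.
    exists (z b); rewrite /= subrr normr0; case: b; do !split=> //.
    1,2: by rewrite divr_gt0.
  have clz b w : closure (P `&` [set x | `|k (gact g x) - k (gact g (z b))| < e / 4]) w ->
      `|k (gact g w) - k (gact g (z b))| <= e / 4.
    have := @closed_dist_le _ _ _ kg (k (gact g (z b))) (e / 4).
    move=> /closure_id; set C := [set _ | _] => CE clw.
    suff : C w by []. rewrite CE; apply: closureS clw => t [_]; exact: ltW.
  exists g; move: (clz _ _ xcl) (clz _ _ x'cl) gyy'; rewrite /z !ler_norml.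
  move=> /andP[? ?] /andP[? ?].
  by rewrite ler_normr lter_normr => /orP[?|?]; apply/orP; [left|right]; lra.
- move=> nu good dec.
  have [n|n|n|x [_ xP]] := @compact_decreasing_nonempty _ setT (closure \o nu) Yc.
  + exact: closed_closure.
  + exact/closureS/dec.
  + have [_ [x [_ nx]]] := good n; exists x; split=> //; exact: subset_closure.
  + by exists x.
- by move=> y y' /codeP yy' [g]; rewrite ltNge yy'.
Qed.

Lemma SUC_sub_Asp : polish R G -> roelcke_precompact G -> SUC R X `<=` Asp R X.
Proof.
move=> pG rG h [_ [Y [nu [k [nuY hk suck]]]]]; exists Y, nu, k; split=> //.
by apply: suc_fragmented_orbit => //; case: nuY.
Qed.

End FragmentedOrbits.

(** * Order patterns *)

Section OrderPatterns.
Context (R : realType).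

(** The margin [d] pays for perturbations; at [d = 0] the condition is closed. *)
Definition side (r s d : R) (b : bool) (v : R) := if b then s + d <= v else v <= r - d.

Lemma side_near r s d b v w : side r s d b v -> `|w - v| < d / 2 ->
  side r s (d / 2) b w.
Proof. by rewrite ltr_norml => + /andP[]; case: b => /=; lra. Qed.

Lemma side0 r s d b v : 0 < d -> side r s d b v -> side r s 0 b v.
Proof. by case: b => /=; lra. Qed.

Lemma closed_side (T : topologicalType) (f : T -> R) r s b : continuous f ->
  closed [set x | side r s 0 b (f x)].
Proof.
move=> fc; case: b => /=.
  have /(_ [set x | s + 0 <= x]) := (continuous_closedP f).1 fc.
  by apply; exact: closed_ge.
have /(_ [set x | x <= r - 0]) := (continuous_closedP f).1 fc.
by apply; exact: closed_le.
Qed.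

Lemma infinite_pigeonhole n (c : nat -> 'I_n.+1) :
  exists i, forall M, exists2 N, (M <= N)%N & c N = i.
Proof.
apply: contrapT => /forallNP nc.
have /choice[M MP] : forall i, exists M, forall N, (M <= N)%N -> c N <> i.
  move=> i; apply: contrapT => /forallNP nM; apply: (nc i) => M.
  apply: contrapT => nN; apply: (nM M) => N MN cN; apply: nN.
  by exists N.
by apply: (MP (c (\max_i M i)) (\max_i M i)) => //; exact: leq_bigmax.
Qed.

Context (G : topologicalGroupType) (h : cb R (left_translation G)) (r s : R).

(** The second clause is a finite half graph, as in a failure of the double limit criterion; [l]
    records the sides imposed on the [x j] by earlier splittings. *)
Definition order_pattern (l : seq (G * bool)) (d : R) (N : nat) :=
  exists g x : nat -> G,
  (forall j p, (j <= N)%N -> p \in l -> side r s d p.2 (h (p.1 * x j)%g)) /\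
  (forall i j, (i <= N)%N -> (j <= N)%N -> side r s d (j < i)%N (h (g i * x j)%g)).

(** The margin does not depend on [N], so patterns of all lengths tolerate the same perturbation. *)
Definition rich (l : seq (G * bool)) :=
  exists2 d, 0 < d & forall N, order_pattern l d N.

(* The middle element of a pattern of length 2N + 2 splits it into two patterns
   of length N + 1; Roelcke precompactness makes this element independent of N,
   at the price of moving the [x j] by elements of [V], which hardly affects
   the conditions in [l]. *)
Lemma rich_split (l : seq (G * bool)) : roelcke_precompact G ->
  RUC R (left_translation G) h -> rich l ->
  exists g, forall b, rich ((g, b) :: l).
Proof.
move=> rG hRUC [d d0 lP].
have d20 : 0 < d / 2 by rewrite divr_gt0.
have [U U1 UP] := hRUC _ d20.
have U0 := nbhs1_inv U1.
(* Conjugation by [p.1] turns a small factor between [p.1] and [x j] into one on the left, where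
   [RUC] controls [h]. *)
have Ul : \forall w \near (1%g : G), forall p, p \in l -> U (p.1 * w * p.1^-1)^-1%g.
  elim: l {lP} => [|q l IH]; first by apply: nearW => w p.
  have /= Uq := nbhs1_conj q.1 U0.
  apply: filterS2 Uq IH => w Uw IH p; rewrite in_cons => /predU1P[->//|].
  exact: IH.
have [n [c [f fP]]] := roelcke_partition rG (filterI U1 Ul).
have /choice[g] := fun N => lP (N.*2.+1).
move=> /choice[x gxP].
have [i iP] := infinite_pigeonhole (fun N => c (g N N.+1)).
exists (f i) => b; exists (d / 2) => // N.
have [M NM cM] := iP N.
have [u [v [[Uu _] [_ lv] gE]]] := fP (g M M.+1).
rewrite cM in gE.
have [xl gx] := gxP M.
(* The [x j] below the middle index [M.+1] have products with the middle element above [s], the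
   others below [r]. *)
pose sh := if b then 0%N else M.+1.
have shM j : (j <= N)%N -> (sh + j <= M.*2.+1)%N by rewrite /sh; case: (b); lia.
(* The factors [v] cancel in the mutual products, and [f i * v] is [u^-1] times the middle element,
   so [f i] inherits its sides up to a small left factor. *)
exists (fun i => g M (sh + i)%N * v^-1)%g, (fun j => v * x M (sh + j)%N)%g.
split=> [j p jN|i' j i'N jN]; last first.
  rewrite mulgA mulgVK; have := gx _ _ (shM _ i'N) (shM _ jN); rewrite ltn_add2l.
  by case: ltnP => _ /=; lra.
rewrite in_cons => /predU1P[->/=|pl].
  have : side r s d b (h (g M M.+1 * x M (sh + j)%N)%g).
    have := gx M.+1 _ _ (shM _ jN).
    have -> : (sh + j < M.+1)%N = b by rewrite /sh; case: (b); lia.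
    by apply; lia.
  move=> /side_near; apply.
  have := UP (g M M.+1 * x M (sh + j)%N)%g u Uu.
  by rewrite /= gE !mulgA mulVg mul1g.
move: (xl _ _ (shM _ jN) pl) => /side_near; apply.
have := UP (p.1 * x M (sh + j)%N)%g _ (lv _ pl).
by rewrite /= invgK !mulgA mulgVK.
Qed.

(** The nodes are rich lists, read as closed conditions on [Y] with margin 0; a pattern for the list
    shows that they are satisfiable. Adding [(g, false)] or [(g, true)] separates the halves by
    [s - r] at [g], against codes at half that scale. *)
Lemma SUC_not_rich (Y : gspace G) (nu : left_translation G -> Y) (k : cb R Y) :
  polish R G -> roelcke_precompact G -> compactification nu -> extends nu h k ->
  strongly_uniformly_continuous k -> r < s -> ~ rich [::].
Proof.
move=> pG rG nuY hk suck rs rich0.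
have hRUC := extends_RUC nuY hk.
have [Yc _ _ nuE _] := nuY.
have e0 : 0 < (s - r) / 2 by rewrite divr_gt0// subr_gt0.
have [code codeP] := strongly_uniformly_continuous_code pG rG Yc suck e0.
pose cl (l : seq (G * bool)) : set Y := 
  \bigcap_(p in [set` l]) [set y | side r s 0 p.2 (k (gact p.1 y))].
refine (@no_cantor_scheme (seq (G * bool)) Y (fun l l' => exists q, l' = q :: l)
  rich cl (fun y y' => exists g, s - r <= `|k (gact g y) - k (gact g y')|)
  code [::] rich0 _ _ _).
- move=> l /(rich_split rG hRUC)[g gP]; exists (fun b => (g, b) :: l).
  split=> [b|y y' yl y'l]; first by split=> //; exists (g, b).
  exists g; move: (yl (g, false)) (y'l (g, true)); rewrite /= !in_cons !eqxx /=.
  move=> /(_ isT) /= ? /(_ isT) /= ?.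
  by rewrite ler_normr; apply/orP; right; lra.
- move=> l good chain.
  have [n|n|n|y [_ yP]] := @compact_decreasing_nonempty _ setT (fun n => cl (l n)) Yc.
  + by apply: closed_bigI => p _; apply: closed_side; exact: orbit_map_continuous.
  + have [q ->] := chain n => y yq p pl; apply: yq => /=.
    by rewrite in_cons; apply/orP; right.
  + have [d d0 /(_ 0%N)[g [x [xl _]]]] := good n.
    exists (nu (x 0%N)); split=> // p pl /=.
    rewrite -nuE -hk; apply: side0 d0 _; exact: xl.
  + by exists y.
- by move=> y y' /codeP yy' [g]; rewrite leNgt (le_lt_trans (yy' g))//; lra.
Qed.

End OrderPatterns.

(** * Bounded convergence for functionals on bounded continuous functions *)

Section BoundedConvergence.
Context (R : realType) (X : topologicalType).
Implicit Types (f a b w : X -> R).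

Definition mk_cb f (fc : continuous f) (K : R) (fK : forall x, `|f x| <= K) :
  cb R X := Cb (introT (@cb_predP R X f) (conj fc (ex_intro _ K fK))).

Lemma cb_norm_le (h : cb R X) (K : R) : 0 <= K -> (forall x, `|h x| <= K) ->
  `|h| <= K.
Proof. exact: sup_norm_le. Qed.

Lemma cb_norm_ub (h : cb R X) x : `|h x| <= `|h|.
Proof. exact: sup_norm_ub. Qed.

Lemma dual_bounded (phi : dual (cb R X)) : exists C : R, 0 < C /\
  forall h, `|sval phi h| <= C * `|h|.
Proof.
case: phi => f fc /=.
have /linear_boundedP/pinfty_ex_gt0[C C0 CP] :
  bounded_near f (nbhs (0 : cb R X)) by exact: continuous_linear_bounded (fc 0).
by exists C.
Qed.

Section Upper.
Variable phi : dual (cb R X).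

(* The total variation of [phi], evaluated at a nonnegative function *)
Definition variation a : R :=
  sup [set sval phi g | g in [set g : cb R X | forall x, `|g x| <= a x]].

Definition nonneg_bounded K a := continuous a /\ forall x, 0 <= a x <= K.

Lemma variation_has_sup K a : nonneg_bounded K a ->
  has_sup [set sval phi g | g in [set g : cb R X | forall x, `|g x| <= a x]].
Proof.
move=> [_ aK]; have [C [C0 CP]] := dual_bounded phi; split.
  exists (sval phi 0), 0 => //= x.
  by rewrite normr0; case/andP: (aK x).
exists (C * `|K|) => _ [g ga <-]; apply: le_trans (ler_norm _) _.
apply: le_trans (CP g) _; rewrite ler_pM2l//; apply: cb_norm_le => // x.
by apply: le_trans (ga x) _; case/andP: (aK x) => _ /le_trans; apply; exact: ler_norm.
Qed.

Lemma variation_ub K a (g : cb R X) : nonneg_bounded K a ->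
  (forall x, `|g x| <= a x) -> `|sval phi g| <= variation a.
Proof.
move=> aK ga; have ub := sup_upper_bound (variation_has_sup aK).
rewrite ler_norml lerNl -raddfN; apply/andP; split; apply: ub.
  by exists (- g) => // x /=; rewrite normrN.
by exists g.
Qed.

Lemma variation_le K L a b : nonneg_bounded K a -> nonneg_bounded L b ->
  (forall x, a x <= b x) -> variation a <= variation b.
Proof.
move=> aK bL ab; apply: ge_sup; first by case: (variation_has_sup aK).
move=> _ [g ga <-]; apply: le_trans (ler_norm _) _; apply: variation_ub bL _.
by move=> x; exact: le_trans (ga x) (ab x).
Qed.

Lemma variation_cst (C c : R) a : (forall h, `|sval phi h| <= C * `|h|) ->
  nonneg_bounded c a -> 0 <= C -> 0 <= c -> variation a <= C * c.
Proof.
move=> CP ac C0 c0; apply: ge_sup; first by case: (variation_has_sup ac).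
move=> _ [g ga <-]; apply: le_trans (ler_norm _) _; apply: le_trans (CP _) _.
rewrite ler_wpM2l//; apply: cb_norm_le => // x; apply: le_trans (ga x) _.
by case: ac => _ /(_ x)/andP[].
Qed.

Lemma nonneg_bounded_min K a b : nonneg_bounded K a -> nonneg_bounded K b ->
  nonneg_bounded K (a \min b).
Proof.
move=> [ac aK] [bc bK]; split=> [|x].
  by move=> x; apply: min_fun_continuous.
move: (aK x) (bK x) => /andP[? ?] /andP[? ?] /=.
by rewrite le_min ge_min; do ?[apply/andP; split=> //]; apply/orP; left.
Qed.

Lemma nonneg_bounded_max K a b : nonneg_bounded K a -> nonneg_bounded K b ->
  nonneg_bounded K (a \max b).
Proof.
move=> [ac aK] [bc bK]; split=> [|x].
  by move=> x; apply: max_fun_continuous.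
move: (aK x) (bK x) => /andP[? ?] /andP[? ?] /=.
by rewrite ge_max le_max; do ?[apply/andP; split=> //]; apply/orP; left.
Qed.

(** Let [f] and [g] nearly attain the variations at [a] and [b]. Truncating [f + g] at the minimum,
    above and below, splits it into a part dominated by [a \min b] and a remainder dominated by
    [a \max b], because minimum and maximum add up to [a + b]. *)
Lemma variation_modular K a b : nonneg_bounded K a -> nonneg_bounded K b ->
  variation a + variation b <= variation (a \min b) + variation (a \max b).
Proof.
move=> aK bK.
have mK := nonneg_bounded_min aK bK; have MK := nonneg_bounded_max aK bK.
apply/ler_addgt0Pr => e e0; have e20 : 0 < e / 2 by rewrite divr_gt0.
have [_ [f fa <-] af] := sup_adherent e20 (variation_has_sup aK).
have [_ [g gb <-] bg] := sup_adherent e20 (variation_has_sup bK).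
pose m := a \min b.
pose u x := Num.max (- m x) (Num.min (m x) (f x + g x)).
have uc : continuous u.
  have mc : continuous m by case: mK.
  have nc : continuous (fun x => - m x) by move=> x; exact: continuousN (mc x).
  have fgc : continuous (fun x => f x + g x).
    have fc := @cb_continuous R X f; have gc := @cb_continuous R X g.
    by move=> x; exact: (@continuousD _ R^o X f g x (fc x) (gc x)).
  exact: max_fun_continuous nc (min_fun_continuous mc fgc).
have m0 x : 0 <= m x by case: mK => _ /(_ x)/andP[].
have um x : `|u x| <= m x.
  rewrite ler_norml /u le_max lexx /= ge_max.
  by rewrite ge_min lexx andbT (le_trans _ (m0 x))// oppr_le0.
have uK x : `|u x| <= K.
  by apply: le_trans (um x) _; case: mK => _ /(_ x)/andP[].
pose cu := mk_cb uc uK.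
have := variation_ub mK (g := cu) um.
have vM x : `|f x + g x - u x| <= (a \max b) x.
  have := fa x; have := gb x; rewrite /= /u /m /= !ler_norml.
  move=> /andP[? ?] /andP[? ?].
  have : Num.min (a x) (b x) + Num.max (a x) (b x) = a x + b x.
    exact: addr_min_max.
  move: (m0 x); rewrite /m /=.
  set p := Num.min (a x) (b x); set q := Num.max (a x) (b x) => ? ?.
  have pq : p <= q by rewrite /p /q le_max ge_min lexx.
  case: (leP p (f x + g x)) => ?.
    by case: (leP (- p) p) => ?; apply/andP; split; lra.
  by case: (leP (- p) (f x + g x)) => ?; apply/andP; split; lra.
have := variation_ub MK (g := f + g - cu) vM.
rewrite raddfB raddfD /= => /(le_trans (ler_norm _)) ? /(le_trans (ler_norm _)) ?.
rewrite -/(variation a) in af; rewrite -/(variation b) in bg.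
by lra.
Qed.

End Upper.
End BoundedConvergence.

Section DominatedSequences.
Context (R : realType) (X : topologicalType) (q : nat -> X -> R) (K : R).
Hypothesis qK : forall n, nonneg_bounded K (q n).

Inductive tail_max (m : nat) : (X -> R) -> Prop :=
| tail_max_term n : (m <= n)%N -> tail_max m (q n)
| tail_max_join w w' : tail_max m w -> tail_max m w' -> tail_max m (w \max w').

Lemma tail_maxW m n w : (m <= n)%N -> tail_max n w -> tail_max m w.
Proof.
move=> mn; elim=> [i ni|w1 w2 _ IH1 _ IH2]; last exact: tail_max_join.
by apply: tail_max_term; exact: leq_trans ni.
Qed.

Lemma tail_max_nonneg_bounded m w : tail_max m w -> nonneg_bounded K w.
Proof. by elim=> [n _|w1 w2 _ IH1 _ IH2]; [exact: qK|exact: nonneg_bounded_max]. Qed.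

Lemma tail_max_le m w : tail_max m w -> exists N, forall c x, c <= w x ->
  exists2 n, (m <= n <= N)%N & c <= q n x.
Proof.
elim=> [n mn|w1 w2 _ [N1 IH1] _ [N2 IH2]].
  by exists n => c x cq; exists n => //; rewrite mn /=.
exists (maxn N1 N2) => c x /=; rewrite le_max => /orP[/IH1|/IH2] [n /andP[mn nN] cn].
  by exists n => //; rewrite mn leq_max nN.
by exists n => //; rewrite mn leq_max nN orbT.
Qed.

(* Let [s j] be the supremum of the variations of finite maxima of terms of
   index at least [j]. If [Q j] nearly attains [s j] then, by modularity, the
   minimum of [Q 0], ..., [Q m] still has variation about [s m]. *)
Lemma variation_recurrent (phi : dual (cb R X)) (d : R) : 0 <= K -> 0 < d ->
  (forall n, d <= variation phi (q n)) ->
  exists2 c, 0 < c & exists N : nat -> nat, forall m, exists x, forall j,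
    (j <= m)%N -> exists2 n, (j <= n <= N j)%N & c <= q n x.
Proof.
move=> K0 d0 dq; have [C [C0 CP]] := dual_bounded phi.
(* A nonnegative function bounded by [c] has variation at most [C * c = d / 4]. *)
pose c := d / (4 * C); have c0 : 0 < c by rewrite divr_gt0// mulr_gt0.
pose E j := [set variation phi w | w in tail_max j].
have supE j : has_sup (E j).
  split; first by exists (variation phi (q j)), (q j) => //; exact: tail_max_term.
  exists (C * K) => _ [w /tail_max_nonneg_bounded wK <-].
  exact: variation_cst CP wK (ltW C0) K0.
have s_ub j w : tail_max j w -> variation phi w <= sup (E j).
  by move=> wj; apply: sup_upper_bound => //; exists w.
pose e j := d / 4 / 2 ^+ j; have e0 j : 0 < e j by rewrite !divr_gt0// exprn_gt0.
have /choice[Q QP] j : exists w, tail_max j w /\ sup (E j) - e j < variation phi w.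
  by have [_ [w wj <-] ws] := sup_adherent (e0 j) (supE j); exists w.
have /choice[N NP] j := tail_max_le (QP j).1.
exists c => //; exists N => m.
(* [r] is the minimum of [Q 0], ..., [Q m]. Since [r <= Q j], the maximum of [r] and [Q j.+1] lies
   below a finite maximum of index at least [j]; as [e j] is twice [e j.+1], modularity preserves
   the bound on the loss. *)
have [r [rK _ rs rP]] : exists r, [/\ nonneg_bounded K r, forall x, r x <= Q m x,
    sup (E m) - (d / 2 - e m) <= variation phi r &
    forall x, c <= r x -> forall j, (j <= m)%N -> c <= Q j x].
  elim: m => [|j [r [rK rQ rs rP]]].
    have [Q0 Qs] := QP 0%N; exists (Q 0%N); split=> //.
    - exact: tail_max_nonneg_bounded Q0.
    - by move: Qs; rewrite /e expr0 divr1; lra.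
    - by move=> x cx j; rewrite leqn0 => /eqP->.
  have [Qj Qs] := QP j.+1; have QK := tail_max_nonneg_bounded Qj.
  have joinK := tail_max_join (QP j).1 (tail_maxW (leqnSn j) Qj).
  exists (r \min Q j.+1); split.
  - exact: nonneg_bounded_min.
  - by move=> x /=; rewrite ge_min lexx orbT.
  - have := variation_modular phi rK QK.
    have : variation phi (r \max Q j.+1) <= sup (E j).
      apply: le_trans (s_ub _ _ joinK).
      apply: variation_le; [exact: nonneg_bounded_max rK QK|
        exact: tail_max_nonneg_bounded joinK|].
      by move=> x /=; rewrite ge_max !le_max rQ lexx orbT.
    have : e j = e j.+1 + e j.+1.
      by rewrite /e exprSr invfM mulrA -splitr.
    by move: rs Qs; lra.
  - move=> x /=; rewrite le_min => /andP[cr cQ] i; rewrite leq_eqVlt.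
    by move=> /predU1P[->//|/rP]; exact.
apply: contrapT => /forallNP nx.
have rc x : r x < c.
  rewrite ltNge; apply/negP => /rP cQ; apply: (nx x) => j /cQ; exact: NP.
have : variation phi r <= C * c.
  apply: variation_cst CP _ (ltW C0) (ltW c0); case: rK => rcont rK.
  by split=> // x; rewrite (ltW (rc x)) andbT; case/andP: (rK x).
have sd : d <= sup (E m).
  by apply: le_trans (dq m) _; apply: s_ub; exact: tail_max_term.
have -> : C * c = d / 4 by rewrite /c; field; rewrite gt_eqF.
by move: rs (e0 m); lra.
Qed.

End DominatedSequences.

(** * From SUC to WAP *)

Lemma filter_forall_ltn (T : Type) (F : set_system T) (P : nat -> set T) (n : nat) :
  Filter F -> (forall i, F (P i)) -> F [set t | forall i, (i < n)%N -> P i t].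
Proof.
move=> FF FP; elim: n => [|n IH]; first by apply: (@filterE _ F FF) => t i.
apply: (@filterS _ F FF _ _ _ (@filterI _ F FF _ _ (FP n) IH)) => t [Pn Pt] i.
by rewrite ltnS leq_eqVlt => /predU1P[->//|/Pt].
Qed.

Lemma dense_nbhs (T : topologicalType) (S A : set T) (t : T) :
  dense S -> nbhs t A -> (A `&` S) !=set0.
Proof.
move=> dS tA; have [|x [Ax Sx]] := dS (interior A) _ (open_interior A).
  by exists t.
by exists x; split=> //; exact: interior_subset.
Qed.

(** * Pointwise limits of orbits and their continuity *)

Section OrbitLimits.
Context (R : realType) (G : topologicalGroupType).

(** This is the closure of the orbit of [k] in the product topology of [R^Y]. *)
Definition orbit_limit (Y : gspace G) (k : cb R Y) (z : Y -> R) :=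
  forall (s : seq Y) (e : R), 0 < e ->
    exists g, forall y, y \in s -> `|k (gact g y) - z y| < e.

Lemma orbit_limit_bound (Y : gspace G) (k : cb R Y) (z : Y -> R) (M : R) :
  (forall y, `|k y| <= M) -> orbit_limit k z -> forall y, `|z y| <= M.
Proof.
move=> kM zk y; apply/ler_addgt0Pr => e e0.
have [g /(_ y (mem_head _ _))] := zk [:: y] e e0.
move: (kM (gact g y)); rewrite !ler_norml ltr_norml => /andP[? ?] /andP[? ?].
by apply/andP; split; lra.
Qed.

Lemma pointwise_near_seq (Y : eqType) (F : set_system (Y -> R)) (z : Y -> R)
    (s : seq Y) (e : R) : Filter F -> F --> (z : {ptws Y -> R}) -> 0 < e ->
  F [set z' | forall y, y \in s -> `|z' y - z y| < e].
Proof.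
move=> FF /cvg_pointwiseP Fz e0; elim: s => [|y s IH].
  by apply: (@filterE _ F FF) => z' y.
have Hy : F [set z' | `|z' y - z y| < e] by exact: cvgr_distC_lt (Fz y) _ e0.
apply: (@filterS _ F FF _ _ _ (@filterI _ F FF _ _ Hy IH)) => z' [z'y z's] y'.
by rewrite in_cons => /predU1P[->//|/z's].
Qed.

Lemma orbit_limit_cluster (Y : gspace G) (k : cb R Y) (F : set_system (Y -> R)) :
  ProperFilter F -> F (orbit_limit k) -> exists z, orbit_limit k z /\
    forall A, F A -> forall (s : seq Y) (e : R), 0 < e ->
      exists2 z', A z' & forall y, y \in s -> `|z' y - z y| < e.
Proof.
move=> FF Fk; have [M [M0 kM]] := cb_bounded k.
have := @tychonoff Y (fun=> R) (fun=> [set` `[- M, M]%R]) (fun=> @segment_compact R _ _).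
move=> /(_ F FF)[|z [_ Fz]].
  apply: filterS Fk => z /(orbit_limit_bound kM) zM y /=.
  by rewrite in_itv /= -ler_norml.
have zclose A : F A -> forall (s : seq Y) (e : R), 0 < e ->
    exists2 z', A z' & forall y, y \in s -> `|z' y - z y| < e.
  move=> FA s e e0.
  have := pointwise_near_seq s (nbhs_filter (z : {ptws Y -> R})) (@cvg_id _ _) e0.
  by move=> /(Fz _ _ FA)[z' [Az' z'P]]; exists z'.
exists z; split=> // s e e0; have e20 : 0 < e / 2 by rewrite divr_gt0.
have [z' z'k z'z] := zclose _ Fk s _ e20.
have [g gP] := z'k s _ e20; exists g => y ys.
move: (z'z y ys) (gP y ys); rewrite !ltr_norml => /andP[? ?] /andP[? ?].
by apply/andP; split; lra.
Qed.

Section StronglyUniformlyContinuous.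
Hypotheses (pG : polish R G) (rG : roelcke_precompact G).

(* Otherwise a Grothendieck double sequence [g i], [y j] near [y0] would yield
   arbitrarily long order patterns. *)
Lemma suc_orbit_limit_usc (h : cb R (left_translation G)) (Y : gspace G)
    (nu : left_translation G -> Y) (k : cb R Y) (z : Y -> R) (y0 : Y) (e : R) :
  compactification nu -> extends nu h k -> strongly_uniformly_continuous k ->
  orbit_limit k z -> 0 < e -> \forall y \near y0, z y < z y0 + e.
Proof.
move=> nuY hk suck zk e0; apply: contrapT => nlt.
have e12 : 0 < e / 12 by rewrite divr_gt0.
(* Three errors of [e / 12] put the low values below [z y0 + e / 4], and two put the high ones above
   [z y0 + 5 e / 6]: exactly these thresholds with margin [e / 12]. *)
have rs : z y0 + e / 3 < z y0 + e * 3 / 4 by lra.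
apply: (SUC_not_rich pG rG nuY hk suck rs); exists (e / 12) => // N.
have [g [y [gy0 gy_small gy_large]]] : exists (g : nat -> G) (y : nat -> Y), [/\
    forall i, (i < N.+1)%N -> `|k (gact (g i) y0) - z y0| < e / 12,
    forall i j, (j < N.+1)%N -> (i <= j)%N ->
      `|k (gact (g i) (y j)) - k (gact (g i) y0)| < e / 12 &
    forall i j, (i < N.+1)%N -> (j < i)%N ->
      z y0 + e - e / 12 < k (gact (g i) (y j))].
  (* The induction also keeps [z (y j)] large: the next [g] approximates [z] at [y0] and at all
     earlier [y j], and the next [y] is then taken so near [y0] that every chosen [g] barely
     notices. *)
  suff [g [y [? ? ? _]]] : exists (g : nat -> G) (y : nat -> Y), [/\
    forall i, (i < N.+1)%N -> `|k (gact (g i) y0) - z y0| < e / 12,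
    forall i j, (j < N.+1)%N -> (i <= j)%N ->
      `|k (gact (g i) (y j)) - k (gact (g i) y0)| < e / 12,
    forall i j, (i < N.+1)%N -> (j < i)%N ->
      z y0 + e - e / 12 < k (gact (g i) (y j)) &
    forall j, (j < N.+1)%N -> z y0 + e <= z (y j)] by exists g, y.
  elim: N.+1 => [|n [g [y [g0 gs gl zy]]]]; first by exists (fun=> 1%g), (fun=> y0).
  have [g' g'P] := zk (y0 :: [seq y j | j <- iota 0 n]) _ e12.
  pose gn i := if i == n then g' else g i.
  have near_y : \forall y' \near y0, forall i, (i < n.+1)%N ->
      `|k (gact (gn i) y') - k (gact (gn i) y0)| < e / 12.
    have ni i : \forall y' \near y0, `|k (gact (gn i) y') - k (gact (gn i) y0)| < e / 12.
      exact: (cvgr_distC_lt _ _ (@orbit_map_continuous R G Y k (gn i) y0) _ e12).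
    exact: filter_forall_ltn.
  have [y' y'P zy'] : exists2 y', (forall i, (i < n.+1)%N ->
      `|k (gact (gn i) y') - k (gact (gn i) y0)| < e / 12) & z y0 + e <= z y'.
    apply: contrapT => ny'; apply: nlt; apply: filterS near_y => y' y'P.
    by rewrite ltNge; apply/negP => zy'; apply: ny'; exists y'.
  exists gn, (fun j => if j == n then y' else y j); split=> [i|i j jn ij|i j iN ji|j].
  - rewrite /gn; case: eqP => [_ _|/eqP iNn iln]; first exact: g'P (mem_head _ _).
    by apply: g0; lia.
  - case: eqP => [jE|/eqP jNn]; first by apply: y'P; lia.
    by rewrite /gn; case: eqP => [|_]; [lia|apply: gs; lia].
  - have -> : (j == n) = false by lia.
    rewrite /gn; case: eqP => [iE|/eqP iNn]; last by apply: gl; lia.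
    have := g'P (y j); rewrite in_cons map_f ?orbT ?mem_iota; last lia.
    move=> /(_ isT); rewrite ltr_norml => /andP[? ?].
    by have := zy j; rewrite -iE => /(_ ji); lra.
  - by case: eqP => // /eqP jNn jn; apply: zy; lia.
have [_ _ _ nuE nud] := nuY.
have /choice[x xP] j : exists x, forall i, (i < N.+1)%N ->
    `|k (gact (g i) (nu x)) - k (gact (g i) (y j))| < e / 12.
  have ni i : \forall y' \near y j,
      `|k (gact (g i) y') - k (gact (g i) (y j))| < e / 12.
    exact: (cvgr_distC_lt _ _ (@orbit_map_continuous R G Y k (g i) (y j)) _ e12).
  have [y' [y'P [x _ xE]]] := dense_nbhs nud (filter_forall_ltn N.+1 _ ni).
  by exists x; rewrite xE.
exists g, x; split=> // i j iN jN.
have /= gx : h (g i * x j)%g = k (gact (g i) (nu (x j))).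
  by rewrite hk -nuE.
have := xP j i iN; rewrite gx ltr_norml => /andP[? ?].
case: ltnP => /= [ji|ij]; first by have := gy_large i j iN ji; lra.
move: (gy0 i iN) (gy_small i j jN ij); rewrite !ltr_norml.
by move=> /andP[? ?] /andP[? ?]; lra.
Qed.

(** Upper semicontinuity for [- h] and [- z] supplies the lower half. *)
Lemma suc_orbit_limit_continuous (h : cb R (left_translation G)) (Y : gspace G)
    (nu : left_translation G -> Y) (k : cb R Y) (z : Y -> R) :
  compactification nu -> extends nu h k -> strongly_uniformly_continuous k ->
  orbit_limit k z -> continuous z.
Proof.
move=> nuY hk suck zk y0; apply/cvgrPdist_lt => e e0.
have up := suc_orbit_limit_usc y0 nuY hk suck zk e0.
have hkN : extends nu (- h) (- k) by move=> x; congr (- _); exact: hk.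
have suckN : strongly_uniformly_continuous (- k).
  move=> y d d0; have [U U1 UP] := suck y d d0; exists U => // g u Uu.
  change (`|- k (gact g y) - - k (gact (g * u)%g y)| < d).
  by rewrite -opprD normrN; exact: UP.
have zkN : orbit_limit (- k) (fun y => - z y).
  move=> s d d0; have [g gP] := zk s d d0; exists g => y ys.
  change (`|- k (gact g y) - - z y| < d).
  by rewrite -opprD normrN; exact: gP.
have lo := suc_orbit_limit_usc y0 nuY hkN suckN zkN e0.
near=> y; rewrite ltr_norml; apply/andP; split.
  by rewrite ltrBrDr addrC ltrBlDr; near: y.
rewrite ltrBlDr -ltrBlDl -[z y]opprK ltrNr opprB addrC.
by near: y.
Unshelve. all: by end_near. Qed.

End StronglyUniformlyContinuous.
End OrbitLimits.

(** * The weak topology tested by functionals *)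

Section WeakTopology.
Context (R : realType).

Lemma cvgR_unique (T : Type) (F : set_system T) (f : T -> R) (l l' : R) :
  ProperFilter F -> f @ F --> l -> f @ F --> l' -> l = l'.
Proof.
move=> FF fl fl'; have PF : ProperFilter (f @ F) by exact: fmap_proper_filter.
exact: (cvg_unique (@norm_hausdorff _ R^o) fl fl').
Qed.

Lemma weak_cvgP (V : normedModType R) (F : set_system V) (v : V) : Filter F ->
  F --> (v : weak V) <-> forall phi : dual V, sval phi @ F --> sval phi v.
Proof.
move=> FF; split=> [/cvg_initialP/cvg_pointwiseP Fv phi|Fv]; first exact: Fv.
by apply/cvg_initialP/cvg_pointwiseP; exact: Fv.
Qed.

Lemma dual_intro (V : normedModType R) (f : V -> R) (C : R) :
  (forall a u v, f (a *: u + v) = a * f u + f v) ->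
  (forall v, `|f v| <= C * `|v|) -> exists phi : dual V, sval phi = f :> (V -> R).
Proof.
move=> lin fC.
pose L : {linear V -> R} :=
  HB.pack f (GRing.isLinear.Build R V R _ f lin).
have Lc : continuous L.
  apply: bounded_linear_continuous; apply/linear_boundedP.
  exists C; split; first exact: num_real.
  by move=> r Cr x; apply: le_trans (fC x) _; rewrite ler_wpM2r// ltW.
by exists (exist _ L Lc).
Qed.

Lemma dual_evaluation (X : topologicalType) (x : X) :
  exists phi : dual (cb R X), forall h, sval phi h = h x.
Proof.
have [|v|phi phiE] := @dual_intro (cb R X) (fun h : cb R X => h x) 1.
- by [].
- by rewrite mul1r cb_norm_ub.
- by exists phi => h; rewrite phiE.
Qed.

Lemma weak_cb_hausdorff (X : topologicalType) : hausdorff_space (weak (cb R X)).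
Proof.
move=> p q; rewrite cluster_cvgE => -[F FF [Fq pF]].
apply/val_inj/funext => x; have [phi phiE] := dual_evaluation x.
have FFil : Filter F by exact: filter_filter.
have phiq := (weak_cvgP (q : cb R X) FFil).1 Fq phi.
have phip := (weak_cvgP (p : cb R X) FFil).1 pF phi.
by have := cvgR_unique FF phip phiq; rewrite !phiE.
Qed.

End WeakTopology.

Section WeakCompactness.
Context (R : realType) (G : topologicalGroupType).

(** The set [K] of orbit limits pulled back to [G] contains the orbit, so its weak compactness
    suffices. An ultrafilter on [K] has a pointwise cluster point, which is continuous; bounded
    convergence makes it a weak limit. *)
Lemma SUC_sub_WAP : polish R G -> roelcke_precompact G ->
  SUC R (left_translation G) `<=` WAP R (left_translation G).
Proof.
move=> pG rG h [_ [Y [nu [k [nuY hk suck]]]]].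
have [Yc _ nuc nuE nud] := nuY.
have limc z := @suc_orbit_limit_continuous R G pG rG h Y nu k z nuY hk suck.
have [D Dd] := separable_sequence (1%g : G) pG.1.
have [M [M0 kM]] := cb_bounded k.
have limM z := @orbit_limit_bound R G Y k z M kM.
pose K : set (weak (cb R (left_translation G))) :=
  [set f | exists2 z, orbit_limit k z & forall x, (f : cb R _) x = z (nu x)].
suff Kc : compact K.
  have oK : cb_orbit h `<=` K.
    move=> _ [g _ <-]; exists (fun y => k (gact g^-1%g y)).
      by move=> s e e0; exists g^-1%g => y _; rewrite subrr normr0.
    by move=> x; rewrite /= hk -nuE.
  rewrite /WAP /= /relatively_weakly_compact.
  apply: (subclosed_compact _ Kc); first exact: closed_closure.
  rewrite [X in _ `<=` X](closure_id K).1; first exact: closureS.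
  exact: compact_closed (@weak_cb_hausdorff R _) Kc.
rewrite compact_ultra => F FU FK; have FF : ProperFilter F by exact: ultra_proper.
(* Outside [K] the value [k] is a dummy. *)
have /choice[E EP] : forall f : cb R (left_translation G), exists z, K f ->
    orbit_limit k z /\ forall x, f x = z (nu x).
  move=> f; have [[z zk fz]|nK] := pselect (K f); first by exists z.
  by exists k.
have EF : ProperFilter (E @ F) by exact: fmap_proper_filter.
have EFk : (E @ F) (orbit_limit k).
  by apply: (@filterS _ F _ _ _ _ FK) => f /EP[fk _]; exact: fk.
have [z [zk zF]] := orbit_limit_cluster EF EFk.
have zc := limc z zk; have zM := limM z zk.
have znuc : continuous (z \o nu).
  by move=> x; apply: continuous_comp; [exact: nuc|exact: zc].
pose f0 := mk_cb znuc (fun x => zM (nu x)).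
exists f0; split; first by exists z.
apply/weak_cvgP => phi; apply/cvgrPdist_lt => e e0.
have [//|FB] := in_ultra_setVsetC
  [set f : cb R (left_translation G) | `|sval phi f0 - sval phi f| < e] FU.
exfalso.
(* A failure of weak convergence is reduced to a sequence that [phi] keeps away from [f0] although
   it converges to [z] on a dense sequence. *)
have /choice[f fP] n : exists f : cb R (left_translation G),
    [/\ e <= `|sval phi f0 - sval phi f|, K f &
      forall i, (i <= n)%N -> `|E f (nu (D i)) - z (nu (D i))| < n.+1%:R^-1].
  have n0 : 0 < n.+1%:R^-1 :> R by rewrite invr_gt0.
  have [|_ [f [Bf Kf] <-] fz] := zF
      (E @` [set f | e <= `|sval phi f0 - sval phi f| /\ K f]) _ [seq nu (D i) | i <- iota 0 n.+1] _ n0.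
    apply: (@filterS2 _ F _ _ _ _ _ FB FK) => f /= /negP; rewrite -leNgt => Bf Kf.
    by exists f.
  exists f; split=> // i iN; apply: fz.
  by rewrite (map_f (nu \o D))// mem_iota.
pose q n x := `|f n x - f0 x|.
have Ef n x : f n x = E (f n) (nu x) by have [_ /EP[_ ->]] := fP n.
have Ek n : orbit_limit k (E (f n)) by have [_ /EP[]] := fP n.
have qK n : nonneg_bounded (M + M) (q n).
  split=> x.
    by apply: cvg_norm; apply: cvgB; exact: cb_continuous.
  rewrite /q normr_ge0 /= (le_trans (ler_normB _ _))// lerD ?zM//.
  by rewrite Ef limM.
have qv n : e <= variation phi (q n).
  have [en _ _] := fP n; apply: le_trans en _; rewrite distrC -raddfB.
  by apply: variation_ub (qK n) _.
have [c c0 [N NP]] := variation_recurrent qK (ltW (addr_gt0 M0 M0)) e0 qv.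
(* The bounds [N j] make the unions finite, hence closed, so compactness yields one [y] where the
   distance to [z] is at least [c] for infinitely many [n]. *)
have [m|m|m|y [_ yP]] := @compact_decreasing_nonempty _ setT (fun m =>
  \bigcap_(j in `I_m.+1) \bigcup_(n in [set n | (j <= n <= N j)%N])
    [set y | c <= `|E (f n) y - z y|]) Yc.
- apply: closed_bigI => j _; apply: closed_bigcup.
    by apply: sub_finite_set (finite_II (N j).+1) => n /= /andP[].
  move=> n _.
  have qc : continuous (fun y => `|E (f n) y - z y|).
    by move=> y; apply: cvg_norm; apply: cvgB; [exact: limc|exact: zc].
  have /(_ [set x | c <= x]) := (continuous_closedP _).1 qc.
  by apply; exact: closed_ge.
- by move=> y yP j /= jm; apply: yP => /=; exact: leqW.
- have [x xP] := NP m; exists (nu x); split=> // j /= jm.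
  by have [n nj cq] := xP j jm; exists n => //=; rewrite -Ef.
have {}yP j : exists2 n, (j <= n)%N & c <= `|E (f n) y - z y|.
  by have [n /andP[jn _] cn] := yP j j (ltnSn j); exists n.
(* A cluster point [w] of these functions equals [z] on a dense set, hence everywhere by continuity,
   although it stays away from [z] at [y]. *)
pose A j := [set E (f n) | n in [set n | (j <= n)%N /\ c <= `|E (f n) y - z y|]].
have AF : ProperFilter (filter_from setT A).
  apply: filter_from_proper; last first.
    by move=> j _; have [n jn cn] := yP j; exists (E (f n)), n.
  apply: filter_from_filter; first by exists 0%N.
  move=> i j _ _; exists (maxn i j) => // _ [n [+ cn] <-].
  by rewrite geq_max => /andP[i_n j_n]; split; exists n.
have [|w [wk wA]] := @orbit_limit_cluster R G Y k _ AF.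
  by exists 0%N => // _ [n _ <-].
have wzD i : w (nu (D i)) = z (nu (D i)).
  apply/eqP; rewrite -subr_eq0 -normr_le0; apply/ler_addgt0Pr => d d0.
  rewrite add0r; have d20 : 0 < d / 2 by rewrite divr_gt0.
  pose j := maxn i (Num.truncn (d / 2)^-1).
  have [|_ [n [jn _] <-] nw] := wA (A j) _ [:: nu (D i)] _ d20; first by exists j.
  have [_ _ /(_ i) fz] := fP n.
  have : n.+1%:R^-1 < d / 2.
    rewrite -[ltRHS]invrK ltf_pV2 ?posrE ?invr_gt0//.
    apply: lt_le_trans (truncnS_gt _) _; rewrite ler_nat ltnS.
    by apply: leq_trans jn; rewrite leq_maxr.
  have := fz (leq_trans (leq_maxl _ _) jn); have := nw _ (mem_head _ _).
  move: (n.+1%:R^-1 : R) => v.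
  rewrite !ltr_norml ler_norml => /andP[? ?] /andP[? ?] ?.
  by apply/andP; split; lra.
have wz : w = z.
  apply/funext => y'; apply: contrapT => /eqP wzy.
  have wc := limc w wk.
  have oV : open [set y | w y - z y != 0].
    have wzc : continuous (fun y => w y - z y).
      by move=> t; apply: cvgB; [exact: wc|exact: zc].
    have /(_ [set t | t != 0]) := (continuousP _).1 wzc.
    by apply; exact: open_neq.
  have [|t [wzt [x _ xt]]] := nud _ _ oV.
    by exists y'; rewrite /= subr_eq0.
  have [||i] := Dd (nu @^-1` [set y | w y - z y != 0]).
  - by apply: (continuousP _).1 oV.
  - by exists x; rewrite /= xt.
  - by rewrite /= wzD subrr eqxx.
have c20 : 0 < c / 2 by rewrite divr_gt0.
have [|_ [n [_ cn] <-] nw] := wA (A 0%N) _ [:: y] _ c20; first by exists 0%N.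
have := nw y (mem_head _ _); rewrite wz.
by move: cn; lra.
Qed.

End WeakCompactness.

(** * From WAP to SUC *)

(** The first [n + 1] coordinates, shifted by [M] to be nonnegative, are rounded to a grid of mesh
    [1 / (n + 1)]. *)
Lemma bounded_partition (R : realType) (T : Type) (a : nat -> T -> R) (M : R) :
  (forall i t, `|a i t| <= M) ->
  exists (B : nat -> nat) (c : forall n, T -> {ffun 'I_n.+1 -> 'I_(B n).+1}),
    forall n t t', c n t = c n t' ->
      forall i, (i <= n)%N -> `|a i t - a i t'| < n.+1%:R^-1.
Proof.
move=> aM.
exists (fun n => Num.truncn ((M + M) * n.+1%:R)).
exists (fun n t => [ffun i : 'I_n.+1 => inord (Num.truncn ((a i t + M) * n.+1%:R))]).
move=> n t t' /ffunP tt' i; rewrite -ltnS => iN.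
have := tt' (Ordinal iN); rewrite !ffunE /= => /(congr1 val) /=.
have n0 : 0 < n.+1%:R :> R by [].
have bound s : 0 <= (a i s + M) * n.+1%:R <= (M + M) * n.+1%:R.
  have := aM i s; rewrite ler_norml => /andP[? ?].
  by rewrite pmulr_lge0// ler_pM2r//; apply/andP; split; lra.
have small s : (Num.truncn ((a i s + M) * n.+1%:R) <
    (Num.truncn ((M + M) * n.+1%:R)).+1)%N.
  by rewrite ltnS; apply: le_truncn; case/andP: (bound s).
rewrite !inordK// => E.
have /andP[t1 t2] := truncn_itv (proj1 (andP (bound t))).
have /andP[t3 t4] := truncn_itv (proj1 (andP (bound t'))).
rewrite -E in t3 t4; rewrite -(natr1 (Num.truncn _)) in t2 t4.
rewrite -(ltr_pM2r n0) mulVf ?gt_eqF//.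
rewrite -{1}(gtr0_norm n0) -normrM mulrBl ltr_norml.
by apply/andP; split; lra.
Qed.

Section UltrafilterLimits.
Context (R : realType) (X : topologicalType).

(** The functional plays the part of a point of the Stone-Cech compactification; the limits exist
    because each [f] takes values in a compact interval. *)
Lemma ultrafilter_limit_functional (I : Type) (U : set_system I) (x : I -> X) :
  UltraFilter U -> exists phi : dual (cb R X),
    forall f : cb R X, (fun i => f (x i)) @ U --> sval phi f.
Proof.
move=> UU; have UP : ProperFilter U by exact: ultra_proper.
have /choice[L LP] : forall f : cb R X, exists l : R, (fun i => f (x i)) @ U --> l.
  move=> f; have [M [M0 fM]] := cb_bounded f.
  have [|l [_ lc]] := @segment_compact R (- M) M ((fun i => f (x i)) @ U) _.
    by apply: (@filterE _ U) => i /=; rewrite in_itv /= -ler_norml.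
  exists l; apply/cvgrPdist_lt => e e0.
  have [//|Ue] := in_ultra_setVsetC [set i | `|l - f (x i)| < e] UU.
  have [|_ [[i ni <-] li]] := lc ((fun i => f (x i)) @` ~` [set i | `|l - f (x i)| < e])
    (ball l e) _ (nbhsx_ballx l e e0).
    by apply: (@filterS _ U _ _ _ _ Ue) => i ni; exists i.
  by have := ni li.
have Luniq (f : cb R X) (l : R) : (fun i => f (x i)) @ U --> l -> L f = l.
  exact: cvgR_unique (LP f).
have [|f|phi phiE] := @dual_intro R (cb R X) L 1.
- move=> a f g; apply: Luniq.
  by apply: cvgD; [apply: cvgM; [exact: cvg_cst|exact: LP]|exact: LP].
- rewrite mul1r ler_norml; apply/andP; split.
    apply: (cvgr_to_ge (LP f)); apply: (@filterE _ U) => i.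
    by have := cb_norm_ub f (x i); rewrite ler_norml => /andP[].
  apply: (cvgr_to_le (LP f)); apply: (@filterE _ U) => i.
  by have := cb_norm_ub f (x i); rewrite ler_norml => /andP[].
- by exists phi => f; rewrite phiE.
Qed.

End UltrafilterLimits.

Lemma eq_continuous_sequence (R : realType) (T : topologicalType) (s : nat -> T)
    (f f' : T -> R) :
  (forall O : set T, open O -> O !=set0 -> exists n, O (s n)) ->
  continuous f -> continuous f' -> (forall i, f (s i) = f' (s i)) -> f =1 f'.
Proof.
move=> sd fc f'c ff' t; apply: contrapT => /eqP ft.
have ffc : continuous (fun x => f x - f' x).
  by move=> x; apply: cvgB; [exact: fc|exact: f'c].
have oV : open [set x | f x - f' x != 0].
  have /(_ [set x | x != 0]) := (continuousP _).1 ffc.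
  by apply; exact: open_neq.
have [|i] := sd _ oV; first by exists t; rewrite /= subr_eq0.
by rewrite /= ff' subrr eqxx.
Qed.

(** * Continuity and moduli of translates of a WAP function *)

Section WeaklyAlmostPeriodic.
Context (R : realType) (G : topologicalGroupType).
Variable h : cb R (left_translation G).
Hypothesis hWAP : WAP R (left_translation G) h.

Let tr (g : G) : cb R (left_translation G) := translate g^-1%g h.

Lemma trE g x : tr g x = h (g * x)%g.
Proof. by rewrite /tr /translate /= invgK. Qed.

Lemma wap_ultrafilter_limit (T : Type) (U : set_system T) (s : T -> G) :
  UltraFilter U -> exists f : cb R (left_translation G),
    forall phi : dual (cb R (left_translation G)),
      (fun t => sval phi (tr (s t))) @ U --> sval phi f.
Proof.
move=> UU; have UP : ProperFilter U by exact: ultra_proper.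
have FP : ProperFilter ((tr \o s) @ U) by exact: fmap_proper_filter.
have [|f [_ fc]] := hWAP FP.
  apply: (@filterE _ U) => t; apply: subset_closure.
  by exists (s t)^-1%g.
exists f => phi; apply/cvgrPdist_lt => e e0.
pose B := [set t | `|sval phi f - sval phi (tr (s t))| < e].
have [//|UB] := in_ultra_setVsetC B UU.
have fV : nbhs (f : weak (cb R (left_translation G)))
    [set f' : cb R _ | `|sval phi f - sval phi f'| < e].
  have /cvgrPdist_lt := (weak_cvgP _ (nbhs_filter f)).1 (@cvg_id _ (nbhs f)) phi.
  exact.
have [|_ [[t nt <-] ft]] := fc ((tr \o s) @` ~` B) _ _ fV.
  by apply: (@filterS _ U _ _ _ _ UB) => t nt; exists t.
by have := nt ft.
Qed.

(** Along an ultrafilter tending to [g0] and avoiding the desired bound, the translates have a weak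
    limit; evaluations identify it as [tr g0], a contradiction. *)
Lemma wap_weak_continuous (phi : dual (cb R (left_translation G))) :
  continuous (fun g => sval phi (tr g)).
Proof.
move=> g0; apply/cvgrPdist_lt => e e0; apply: contrapT => nnear.
pose B := [set g | e <= `|sval phi (tr g0) - sval phi (tr g)|].
have clB : infer (closure B g0).
  move=> A Ag0; apply: contrapT => BA; apply: nnear; apply: filterS Ag0 => g Ag.
  by rewrite ltNge; apply/negP => Bg; apply: BA; exists g.
have FP := within_nbhs_proper clB.
have [U [UU FU]] := ultraFilterLemma FP.
have UP : ProperFilter U by exact: ultra_proper.
have [f fP] := wap_ultrafilter_limit id UU.
have Ug0 : U --> g0.
  by apply: cvg_trans (cvg_within _); exact: FU.
have fE : f = tr g0.
  apply/val_inj/funext => x; have [ev evE] := dual_evaluation R x.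
  have := fP ev; rewrite evE => fx; apply: (cvgR_unique UP fx).
  have -> : (fun g => sval ev (tr g)) = (fun g => h (g * x)%g).
    by apply/funext => g; rewrite evE trE.
  rewrite [\val (tr g0) x]trE.
  have hx : continuous (fun g : G => h (g * x)%g).
    move=> g; apply: (@continuous_comp G G R (fun g => g * x)%g h);
      last exact: cb_continuous.
    by apply: cvg_mulg; [exact: cvg_id|exact: cvg_cst].
  by apply: cvg_trans (hx g0); exact: cvg_app.
have fg0 : (fun g => sval phi (tr g)) @ U --> sval phi (tr g0) by rewrite -fE.
have Ue : U [set g | `|sval phi (tr g0) - sval phi (tr g)| < e].
  exact: cvgr_dist_lt fg0 _ e0.
have UB : U B.
  apply: FU; apply: (@filterE _ (nbhs g0)) => g Bg; exact: Bg.
have [g [/= lt]] := filter_ex (filterI Ue UB).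
by rewrite /B /= leNgt lt.
Qed.

Context (D : nat -> G).
Hypothesis Dd : forall O : set G, open O -> O !=set0 -> exists n, O (D n).

(** Otherwise two sequences of translates agree asymptotically on [D] while [phi] separates them.
    Their weak limits along an ultrafilter are continuous and agree on [D], so they coincide. *)
Lemma wap_left_modulus (phi : dual (cb R (left_translation G))) (e : R) : 0 < e ->
  exists n, forall t t',
    (forall i, (i <= n)%N -> `|h (t * D i)%g - h (t' * D i)%g| < n.+1%:R^-1) ->
    `|sval phi (tr t) - sval phi (tr t')| <= e.
Proof.
move=> e0; apply: contrapT => /forallNP nn.
have /choice[s sP] n : exists s : G * G,
    (forall i, (i <= n)%N -> `|h (s.1 * D i)%g - h (s.2 * D i)%g| < n.+1%:R^-1) /\
    e < `|sval phi (tr s.1) - sval phi (tr s.2)|.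
  apply: contrapT => ns; apply: (nn n) => t t' tt'.
  by rewrite leNgt; apply/negP => ett'; apply: ns; exists (t, t').
have [U [UU FU]] := ultraFilterLemma eventually_filter.
have UP : ProperFilter U by exact: ultra_proper.
have [f fP] := wap_ultrafilter_limit (fun n => (s n).1) UU.
have [f' f'P] := wap_ultrafilter_limit (fun n => (s n).2) UU.
have ff' : f = f'.
  apply/val_inj/funext.
  apply: (eq_continuous_sequence Dd); [exact: cb_continuous|exact: cb_continuous|].
  move=> i; have [ev evE] := dual_evaluation R (D i : left_translation G).
  have ffi : (fun n => h ((s n).1 * D i)%g - h ((s n).2 * D i)%g) @ U -->
      f (D i) - f' (D i).
    rewrite -(evE f) -(evE f') (_ : (fun n => _) =
      (fun n => sval ev (tr (s n).1)) \- (fun n => sval ev (tr (s n).2))).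
      exact: cvgB (fP ev) (f'P ev).
    by apply/funext => n /=; rewrite !evE !trE.
  apply/eqP; rewrite -subr_eq0; apply/eqP.
  apply: (cvgR_unique UP ffi); apply/cvgr0Pnorm_lt => d d0.
  apply: FU; have [N _ NP] := near_infty_natSinv_lt (PosNum d0).
  exists (maxn i N) => // n /=; rewrite geq_max => /andP[i_n N_n].
  by apply: lt_trans ((sP n).1 i i_n) _; exact: NP.
have sub0 : (fun n => sval phi (tr (s n).1) - sval phi (tr (s n).2)) @ U --> (0 : R).
  rewrite -(subrr (sval phi f)) {2}ff'; exact: cvgB (fP phi) (f'P phi).
have Ue : U [set n | `|sval phi (tr (s n).1) - sval phi (tr (s n).2)| < e].
  exact: (cvgr0Pnorm_lt _).1 sub0 e e0.
have [n /=] := filter_ex Ue.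
by rewrite ltNge (ltW (sP n).2).
Qed.

(** The dual argument: two sequences of points become ultrafilter functionals. Applied to [tr g]
    these are continuous in [g] by weak continuity, so agreement on [D] extends to [u]. *)
Lemma wap_right_modulus (u : G) (e : R) : 0 < e ->
  exists n, forall x x',
    (forall i, (i <= n)%N -> `|h (D i * x)%g - h (D i * x')%g| < n.+1%:R^-1) ->
    `|h (u * x)%g - h (u * x')%g| <= e.
Proof.
move=> e0; apply: contrapT => /forallNP nn.
have /choice[s sP] n : exists s : G * G,
    (forall i, (i <= n)%N -> `|h (D i * s.1)%g - h (D i * s.2)%g| < n.+1%:R^-1) /\
    e < `|h (u * s.1)%g - h (u * s.2)%g|.
  apply: contrapT => ns; apply: (nn n) => t t' tt'.
  by rewrite leNgt; apply/negP => ett'; apply: ns; exists (t, t').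
have [U [UU FU]] := ultraFilterLemma eventually_filter.
have UP : ProperFilter U by exact: ultra_proper.
have [phi phiP] := ultrafilter_limit_functional R
  (fun n => (s n).1 : left_translation G) UU.
have [psi psiP] := ultrafilter_limit_functional R
  (fun n => (s n).2 : left_translation G) UU.
have cvgD_ g : (fun n => h (g * (s n).1)%g - h (g * (s n).2)%g) @ U -->
    sval phi (tr g) - sval psi (tr g).
  rewrite (_ : (fun n => _) = (fun n => tr g (s n).1) \- (fun n => tr g (s n).2)).
    exact: cvgB (phiP (tr g)) (psiP (tr g)).
  by apply/funext => n /=; rewrite invgK.
have E : forall g, sval phi (tr g) = sval psi (tr g).
  apply: (eq_continuous_sequence Dd); [exact: wap_weak_continuous..|].
  move=> i; apply/eqP; rewrite -subr_eq0; apply/eqP.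
  apply: (cvgR_unique UP (cvgD_ (D i))); apply/cvgr0Pnorm_lt => d d0.
  apply: FU; have [N _ NP] := near_infty_natSinv_lt (PosNum d0).
  exists (maxn i N) => // n /=; rewrite geq_max => /andP[i_n N_n].
  by apply: lt_trans ((sP n).1 i i_n) _; exact: NP.
have sub0 : (fun n => h (u * (s n).1)%g - h (u * (s n).2)%g) @ U --> (0 : R).
  by rewrite -(subrr (sval phi (tr u))) {2}E; exact: cvgD_.
have Ue : U [set n | `|h (u * (s n).1)%g - h (u * (s n).2)%g| < e].
  exact: (cvgr0Pnorm_lt _).1 sub0 e e0.
have [n /=] := filter_ex Ue.
by rewrite ltNge (ltW (sP n).2).
Qed.

End WeaklyAlmostPeriodic.

Lemma cvg_coordinate (I : Type) (T : topologicalType) (z : {ptws I -> T}) (i : I) :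
  (fun y : {ptws I -> T} => y i) @ z --> z i.
Proof. exact: (cvg_pointwiseP z (nbhs_filter z)).1 (@cvg_id _ _) i. Qed.

(** * Right uniform continuity and the hull of a function *)

Section OrbitClosure.
Context (R : realType) (G : topologicalGroupType).

(** The right modulus codes the functions [x |-> h (u * x)] countably, so Baire category gives a [u]
    of equicontinuity; replacing [x] by [u^-1 * x] moves it to the identity. *)
Lemma WAP_sub_RUC : polish R G ->
  WAP R (left_translation G) `<=` RUC R (left_translation G).
Proof.
move=> pG h hWAP e e0.
have [D Dd] := separable_sequence (1%g : G) pG.1.
have [M [_ hM]] := cb_bounded h.
have [B [c cP]] := bounded_partition (fun i x => hM (D i * x)%g).
have e40 : 0 < e / 4 by rewrite divr_gt0.
have [x|d d0|u uP] := @equicontinuity_point R G 1%g G (fun u x => h (u * x)%g)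
    pG.2 _ _ _ e40.
- move=> u; apply: (@continuous_comp G G R (fun g => g * x)%g h).
    by apply: cvg_mulg; [exact: cvg_id|exact: cvg_cst].
  exact: (@cb_continuous R (left_translation G) h).
- have d3 : 0 < d / 3 by rewrite divr_gt0.
  have [u|code codeP] := finite_partition_code (c := c)
      (Phi := fun u x => h (u * x)%g) d3.
    have [n nP] := wap_right_modulus hWAP Dd u d3.
    by exists n => t t' /cP; exact: nP.
  exists code => u v /codeP uv x; apply: le_trans (uv x) _.
  by rewrite -(mulr_natr (d / 3)) divfK.
have := nbhs1_inv (nbhs_mulr uP) => V1.
exists [set g | forall x, `|h (g^-1 * u * x)%g - h (u * x)%g| <= e / 4].
  exact: V1.
move=> x g /(_ (u^-1 * x)%g); rewrite -!mulgA mulVKg => gx.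
by apply: le_lt_trans gx _; lra.
Qed.

Context (h : cb R (left_translation G)).

Definition right_translates : set {ptws G -> R} :=
  range (fun (x : G) (g : G) => h (g * x)%g).

Definition orbit_closure : set {ptws G -> R} := closure right_translates.

Lemma orbit_closure_approx (y : G -> R) : orbit_closure y ->
  forall (s : seq G) (e : R), 0 < e ->
    exists x, forall g, g \in s -> `|h (g * x)%g - y g| < e.
Proof.
move=> yc s e e0.
have [_ [[x _ <-] xP]] := yc _
  (pointwise_near_seq s (nbhs_filter (y : {ptws G -> R})) (@cvg_id _ _) e0).
by exists x.
Qed.

Lemma orbit_closure_compact : compact orbit_closure.
Proof.
have [M [M0 hM]] := cb_bounded h.
have box : compact ([set y | forall g, [set` `[- M, M]%R] (y g)] : set {ptws G -> R}).
  exact: (@tychonoff G (fun=> R) (fun=> [set` `[- M, M]%R])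
    (fun=> @segment_compact R _ _)).
apply: (subclosed_compact _ box); first exact: closed_closure.
move=> y yc g; rewrite /= in_itv /= -ler_norml; apply/ler_addgt0Pr => e e0.
have [x /(_ g (mem_head _ _))] := orbit_closure_approx yc [:: g] e0.
move: (hM (g * x)%g); rewrite !ler_norml ltr_norml => /andP[? ?] /andP[? ?].
by apply/andP; split; lra.
Qed.

Lemma orbit_closure_act (a : G) (y : {ptws G -> R}) : orbit_closure y ->
  orbit_closure (fun g => y (g * a)%g).
Proof.
move=> yc A Ay.
have FF := fmap_filter (fun (y : {ptws G -> R}) g => y (g * a)%g) (nbhs_filter y).
have actc : (fun (y : {ptws G -> R}) g => y (g * a)%g) @ y -->
    ((fun g => y (g * a)%g) : {ptws G -> R}).
  by apply/(cvg_pointwiseP _ FF) => g; exact: cvg_coordinate.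
have [_ [[x _ <-] Ax]] := yc _ (actc A Ay).
exists (fun g => h (g * (a * x))%g); split; first by exists (a * x)%g.
by move: Ax; rewrite /=; under eq_fun do rewrite -mulgA.
Qed.

(** The compactification generated by [h]: a group element [x] becomes the function
    [g |-> h (g * x)], so [G] acts by right shifts of the argument. *)
Definition hull : topologicalType := set_type orbit_closure.

Definition hull_point (y : {ptws G -> R}) (yc : orbit_closure y) : hull :=
  exist _ y (mem_set yc).

Lemma hullP (y : hull) : orbit_closure (\val y).
Proof. exact: set_mem (valP y). Qed.

Definition hull_act (a : G) (y : hull) : hull :=
  hull_point (@orbit_closure_act a _ (@hullP y)).

Lemma hull_act1 (y : hull) : hull_act 1%g y = y.
Proof. by apply/val_inj/funext => g /=; rewrite mulg1. Qed.

Lemma hull_actM (a b : G) (y : hull) :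
  hull_act (a * b)%g y = hull_act a (hull_act b y).
Proof. by apply/val_inj/funext => g /=; rewrite mulgA. Qed.

Lemma cvg_hullP (T : Type) (F : set_system T) (f : T -> hull) (y : hull) :
  Filter F -> f @ F --> y <-> forall g, (fun t => \val (f t) g) @ F --> \val y g.
Proof.
move=> FF; have FfF : Filter (f @ F) by exact: fmap_filter.
split=> [/cvg_initialP fy g|fy].
  by have /cvg_pointwiseP := fy; exact.
by apply/cvg_initialP/cvg_pointwiseP; exact: fy.
Qed.

Lemma hull_modulus (y : hull) (U : set G) (e : R) :
  (forall (x : left_translation G) g, U g -> `|h (gact g^-1%g x) - h x| < e) ->
  forall u g, U u -> `|\val y (u^-1 * g)%g - \val y g| <= e.
Proof.
move=> UP u g Uu; apply/ler_addgt0Pr => d d0; have d20 : 0 < d / 2 by rewrite divr_gt0.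
have [x xP] := orbit_closure_approx (@hullP y) [:: (u^-1 * g)%g; g] d20.
have := xP _ (mem_head _ _); have := xP g _; rewrite !inE eqxx orbT => /(_ isT).
have := UP (g * x)%g u Uu; rewrite /= mulgA !ltr_norml ler_norml.
move=> /andP[? ?] /andP[? ?] /andP[? ?].
by apply/andP; split; lra.
Qed.

Hypothesis hRUC : RUC R (left_translation G) h.

(** First [y] varies at the fixed argument [g * a0], then [a] varies uniformly in [y]: [g * a] is
    [u^-1 * (g * a0)] with [u = g * a0 * a^-1 * g^-1] near 1. *)
Lemma hull_act_continuous : continuous (fun z : G * hull => hull_act z.1 z.2).
Proof.
move=> [a0 y0]; apply/cvg_hullP => g /=; apply/cvgrPdist_lt => e e0.
have e20 : 0 < e / 2 by rewrite divr_gt0.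
have [U U1 UP] := hRUC e20.
have ya0 : (fun z : G * hull => \val z.2 (g * a0)%g) @ (a0, y0) --> \val y0 (g * a0)%g.
  have snd0 : (fun z : G * hull => z.2) @ (a0, y0) --> y0 by exact: cvg_snd.
  exact: (cvg_hullP _ _ (nbhs_filter (a0, y0))).1 snd0 (g * a0)%g.
have Ua : \forall z \near (a0, y0), U (g * a0 * z.1^-1 * g^-1)%g.
  have : (fun z : G * hull => g * a0 * z.1^-1 * g^-1)%g @ (a0, y0) -->
      (g * a0 * a0^-1 * g^-1)%g.
    apply: cvg_mulg; last exact: cvg_cst.
    apply: cvg_mulg; first exact: cvg_cst.
    by apply: continuous_cvg; [exact: invg_continuous|exact: cvg_fst].
  by rewrite mulgK mulgV; apply.
have ya : \forall z \near (a0, y0),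
    `|\val y0 (g * a0)%g - \val (z.2 : hull) (g * a0)%g| < e / 2.
  exact: cvgr_dist_lt ya0 _ e20.
move: Ua ya; apply: filterS2 => -[a y] /= Ua ya.
have := @hull_modulus y U _ UP _ (g * a0)%g Ua.
rewrite !invgM !invgK !mulgA mulgVK mulgVK.
move=> yaa0; rewrite [e]splitr.
apply: le_lt_trans (ltr_leD ya yaa0).
have := ler_distD (\val y (g * a0)%g) (\val y0 (g * a0)%g) (\val y (g * a)%g).
by rewrite [in X in _ <= X -> _](distrC _ (\val y (g * a)%g)).
Qed.

End OrbitClosure.

Section HullCompactification.
Context (R : realType) (G : topologicalGroupType).
Context (h : cb R (left_translation G)).
Hypothesis hRUC : RUC R (left_translation G) h.

Definition hull_gspace : gspace G :=
  @GSpace G (hull h) (@hull_act _ _ h) (@hull_act1 _ _ h) (@hull_actM _ _ h)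
    (hull_act_continuous hRUC).

Lemma right_translate_closure (x : G) :
  orbit_closure h (fun g => h (g * x)%g).
Proof. by apply: subset_closure; exists x. Qed.

Definition hull_map (x : left_translation G) : hull_gspace :=
  hull_point (@right_translate_closure x).

Lemma cvg_hull (y : hull h) (g : G) : (fun z : hull h => \val z g) @ y --> \val y g.
Proof. exact: (cvg_hullP _ _ (nbhs_filter y)).1 (@cvg_id _ _) g. Qed.

Lemma hull_cb_subproof :
  (fun y : hull_gspace => \val (y : hull h) 1%g) \in @cb_pred R hull_gspace.
Proof.
apply/cb_predP; split; first by move=> y; exact: cvg_hull.
have [M [M0 hM]] := cb_bounded h; exists M => y; apply/ler_addgt0Pr => e e0.
have [x /(_ 1%g (mem_head _ _))] := orbit_closure_approx (@hullP _ _ _ y) [:: 1%g] e0.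
move: (hM (1 * x)%g); rewrite !ler_norml ltr_norml => /andP[? ?] /andP[? ?].
by apply/andP; split; lra.
Qed.

Definition hull_cb : cb R hull_gspace := Cb hull_cb_subproof.

Lemma hull_extends : extends hull_map h hull_cb.
Proof. by move=> x /=; rewrite mul1g. Qed.

Lemma hull_compactification : compactification hull_map.
Proof.
split.
- move=> F FF _; have FP : ProperFilter (\val @ F) by exact: fmap_proper_filter.
  have [|y [yc Fy]] := @orbit_closure_compact R G h _ FP.
    by apply: (@filterE _ F) => z; exact: hullP.
  exists (hull_point yc); split=> // A B FA.
  rewrite nbhsE => -[_ [ [V oV <-] Vy] VB].
  have [|_ [[z Az <-] Vz]] := Fy (\val @` A) V _ (open_nbhs_nbhs (conj oV Vy)).
    by apply: (@filterS _ F _ _ _ _ FA) => z Az; exists z.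
  by exists z; split=> //; exact: VB.
- move=> p q; rewrite cluster_cvgE => -[F FF [Fq pF]].
  have Ff : Filter F by exact: filter_filter.
  apply/val_inj/funext => g.
  apply: (@cvgR_unique R _ F (fun z : hull h => \val z g)).
    exact: (cvg_hullP id p Ff).1 pF g.
  exact: (cvg_hullP id q Ff).1 Fq g.
- move=> x; apply/cvg_hullP => g /=.
  apply: (@continuous_comp G G R (fun x => g * x)%g h).
    by apply: cvg_mulg; [exact: cvg_cst|exact: cvg_id].
  exact: (@cb_continuous R (left_translation G) h).
- by move=> g x; apply/val_inj/funext => g' /=; rewrite mulgA.
- move=> O [y Oy] oO; have [V oV VO] := oO.
  have yV : nbhs (\val y) V.
    by apply: open_nbhs_nbhs; split=> //; rewrite -VO in Oy.
  have [_ [[x _ <-] Vx]] := @hullP _ _ _ y V yV.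
  by exists (hull_map x); split; [rewrite -VO|exists x].
Qed.

(* Along a point of the hull, [h] is evaluated by an ultrafilter limit, which is
   weakly continuous; equicontinuity then comes from the left modulus. *)
Lemma wap_hull_suc : polish R G -> WAP R (left_translation G) h ->
  strongly_uniformly_continuous hull_cb.
Proof.
move=> pG hWAP y e e0.
have [D Dd] := separable_sequence (1%g : G) pG.1.
(* An ultrafilter above this filter, which converges to [y], gives a functional [L] whose value at
   [x |-> h (g * x)] is [y g]. *)
pose F := filter_from [set p : seq G * R | 0 < p.2]
  (fun p => [set x : left_translation G |
    forall g, g \in p.1 -> `|h (g * x)%g - \val (y : hull h) g| < p.2]).
have FF : ProperFilter F.
  apply: filter_from_proper; last first.
    by move=> [s d] d0; exact: orbit_closure_approx (@hullP _ _ _ y) s d d0.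
  apply: filter_from_filter; first by exists ([::], 1) => /=.
  move=> [s d] [s' d'] /= d0 d'0; exists (s ++ s', Num.min d d').
    by rewrite /= lt_min d0.
  move=> x xP; split=> g gs; have := xP g; rewrite mem_cat gs ?orbT => /(_ isT) /=;
    by rewrite lt_min => /andP[].
have [U [UU FU]] := ultraFilterLemma FF.
have UP : ProperFilter U by exact: ultra_proper.
have [L LP] := @ultrafilter_limit_functional R (left_translation G) _ U id UU.
have LE g : sval L (translate g^-1%g h) = \val (y : hull h) g.
  apply: (cvgR_unique UP (LP _)); apply/cvgrPdist_lt => d d0.
  apply: FU; exists ([:: g], d) => // x /(_ g (mem_head _ _)).
  by rewrite distrC /= invgK.
have [M [_ hM]] := cb_bounded h.
have [B [c cP]] := bounded_partition (fun i t => hM (t * D i)%g).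
have e40 : 0 < e / 4 by rewrite divr_gt0.
have [g|d d0|u uP] := @equicontinuity_point R G 1%g G
    (fun u g => \val (y : hull h) (g * u)%g) pG.2 _ _ _ e40.
- rewrite (_ : (fun u => _) =
      (fun v => sval L (translate v^-1%g h)) \o (fun u => g * u)%g).
    move=> u; apply: (@continuous_comp G G R).
      by apply: cvg_mulg; [exact: cvg_cst|exact: cvg_id].
    exact: wap_weak_continuous.
  by apply/funext => u /=; rewrite LE.
- have d3 : 0 < d / 3 by rewrite divr_gt0.
  have [u|code codeP] := finite_partition_code (c := c)
      (Phi := fun u g => \val (y : hull h) (g * u)%g) d3.
    have [C [C0 CP]] := dual_bounded L.
    (* This functional sends [x |-> h (g * x)] to [y (g * u)], so the left modulus applies to
       [g |-> y (g * u)]. *)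
    have [a f f'|f|phi phiE] := @dual_intro R (cb R (left_translation G))
        (fun f => sval L (translate u^-1%g f)) C.
    + rewrite -linearP; congr (sval L _); exact/val_inj.
    + apply: le_trans (CP _) _; rewrite ler_pM2l//.
      by apply: cb_norm_le => // x; exact: (@cb_norm_ub R _ f (gact u^-1^-1%g x)).
    have [n nP] := wap_left_modulus hWAP Dd phi d3.
    exists n => t t' /cP/nP; rewrite phiE.
    have trM g : translate u^-1%g (translate g^-1%g h) = translate (g * u)^-1%g h.
      by apply/val_inj/funext => x /=; rewrite !invgK mulgA.
    by rewrite !trM !LE.
  exists code => u v /codeP uv x; apply: le_trans (uv x) _.
  by rewrite -(mulr_natr (d / 3)) divfK.
exists [set v | forall g,
  `|\val (y : hull h) (g * (u * v))%g - \val (y : hull h) (g * u)%g| <= e / 4].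
  exact: nbhs_mull uP.
(* Replacing [g] by [g * u^-1] moves equicontinuity from [u] to the identity. *)
move=> g v /(_ (g * u^-1)%g); rewrite !mulgA mulgVK /= !mul1g distrC => gv.
by apply: le_lt_trans gv _; lra.
Qed.

End HullCompactification.

Lemma WAP_sub_SUC (R : realType) (G : topologicalGroupType) : polish R G ->
  WAP R (left_translation G) `<=` SUC R (left_translation G).
Proof.
move=> pG h hWAP; have hRUC := WAP_sub_RUC pG hWAP; split=> //.
exists (hull_gspace hRUC), (hull_map hRUC), (hull_cb hRUC); split.
- exact: hull_compactification.
- exact: hull_extends.
- exact: wap_hull_suc.
Qed.

Unset Implicit Arguments.

Theorem theorem2p9 (R : realType) (G : topologicalGroupType)
    (polishG : polish R G) (roelckeG : roelcke_precompact G) :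
  WAP R (left_translation G) = Asp R (left_translation G) /\
  Asp R (left_translation G) = SUC R (left_translation G).
Proof.
have AspSUC : Asp R (left_translation G) = SUC R (left_translation G).
  by apply/seteqP; split; [exact: Asp_sub_SUC|exact: SUC_sub_Asp].
split=> //; rewrite AspSUC.
by apply/seteqP; split; [exact: WAP_sub_SUC|exact: SUC_sub_WAP].
Qed.
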